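(* Let $f(z)=z+z^2+z^3+o(z^3)$ be a germ of an analytic diffeomorphism of $(\mathbb{C},0)$, with attracting petal $V_+$ and repelling petal $V_-$. The principal part of complex measures $H^f(z)$ for $f$ is analytic on $V_+$ and satisfies $$H^f(z)-H^f(f(z))=\pi z,\qquad z\in V_+.$$ Analogously, the principal part $H^{f^{-1}}(z)$ of complex measures for $f^{-1}$ is analytic on $V_-$ and satisfies $$H^{f^{-1}}(z)-H^{f^{-1}}(f^{-1}(z))=\pi z,\qquad z\in V_-.$$
   Context: $V_+$ and $V_-$ are the (maximal) Leau-Fatou petals: open sets of opening angle $2\pi$ at $0$, centered at the negative and the positive real axis respectively, with $f(V_+)\subset V_+$ and $f^{-1}(V_-)\subset V_-$, on which forward iterates of $f$, respectively of $f^{-1}$, converge to $0$. For $z\in V_+$ let $S^f(z)=\{f^{\circ n}(z):n\in\mathbb{N}_0\}$, and for $z\in V_-$ let $S^{f^{-1}}(z)=\{f^{\circ(-n)}(z):n\in\mathbb{N}_0\}$. $U_\varepsilon$ is the $\varepsilon$-neighborhood of $U\subset\mathbb{C}$. The complex measure of a measurable set $U$ is $\widetilde{A^{\mathbb{C}}}(U)=A(U)\cdot t(U)$, where $A(U)$ is the area and $t(U)\in\mathbb{C}$ the center of mass (i.e. $\iint_U(x+iy)\,dx\,dy$). For fixed $z\in V_+$, as $\varepsilon\to0$, $\widetilde{A^{\mathbb{C}}}(S^f(z)_\varepsilon)=q_1\varepsilon^2\log\varepsilon+H^f(z)\varepsilon^2+q_2\varepsilon^{5/2}\log\varepsilon+O(\varepsilon^{5/2})$,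 with $q_1,q_2$ independent of $z$. The principal part $H^f(z)$ is the coefficient of $\varepsilon^2$ (the first coefficient depending on the initial point), as a function of $z\in V_+$. The principal part $H^{f^{-1}}(z)$, $z\in V_-$, is defined in the same way using $S^{f^{-1}}(z)$. *)

(* Defs.v *)
From HB Require Import structures.
From mathcomp Require Import all_boot all_order all_algebra.
From mathcomp Require Import complex.
From mathcomp Require Import all_classical all_reals all_analysis.

Set Implicit Arguments.
Unset Strict Implicit.
Unset Printing Implicit Defensive.

Import Order.TTheory GRing.Theory Num.Theory.
Import numFieldNormedType.Exports.

Local Open Scope classical_set_scope.
Local Open Scope ring_scope.
Local Open Scope complex_scope.

(* The topology given by the modulus; the library provides it on R[i]^o only. *)
HB.instance Definition _ (R : realType) := NormedModule.copy R[i] R[i]^o.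

Section Definitions.
Variable R : realType.
Local Notation C := R[i].
Local Notation leb2 := ((@lebesgue_measure R \x @lebesgue_measure R)%E).

Definition analytic_at (f : C -> C) (z : C) : Prop :=
  exists a : nat -> C, \forall w \near z,
    series (fun n => a n * (w - z) ^+ n) n @[n --> \oo] --> f w.

Definition analytic_on (U : set C) (f : C -> C) : Prop :=
  forall z, U z -> analytic_at f z.

(* f represents on U, and g represents on f @` U, a germ of analytic
   diffeomorphism of (C, 0) and its inverse. Outside these sets the values of
   f and g are irrelevant. *)
Definition analytic_diffeo (U : set C) (f g : C -> C) : Prop :=
  [/\ open U /\ U 0, f 0 = 0, analytic_on U f,
      open (f @` U) /\ analytic_on (f @` U) g
    & forall z, U z -> g (f z) = z].

(* f(z) = z + z^2 + z^3 + o(z^3) *)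
Definition jet3 (f : C -> C) : Prop :=
  (fun z : C => f z - (z + z ^+ 2 + z ^+ 3)) =o_ (nbhs (0 : C))
  (fun z : C => z ^+ 3).

Definition polar (r t : R) : C := (r * cos t) +i* (r * sin t).

(* Opening angle 2 pi at 0, centered at the ray d * [0, +oo[ (|d| = 1): V
   contains a truncated sector around this ray of every half-angle t < pi. *)
Definition opening_2pi (d : C) (V : set C) : Prop :=
  forall t : R, 0 < t < pi -> exists2 r0 : R, 0 < r0 &
    forall r s : R, 0 < r < r0 -> `|s| < t -> V (d * polar r s).

Definition petal (d : C) (D : set C) (h : C -> C) (V : set C) : Prop :=
  [/\ open V, V `<=` D, opening_2pi d V,
      forall z, V z -> V (h z)
    & forall z, V z -> iter n h z @[n --> \oo] --> (0 : C)].

Definition forward_orbit (h : C -> C) (z : C) : set C :=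
  [set iter n h z | n in [set: nat]].

Definition eps_nbhd (S : set C) (e : R) : set C :=
  [set w | exists2 u, S u & `|w - u| < e%:C].

Definition plane (U : set C) : set (R * R) := [set p | U (p.1 +i* p.2)].

Definition area (U : set C) : R := fine (leb2 (plane U)).

Definition center_of_mass (U : set C) : C :=
  ((\int[leb2]_(p in plane U) p.1) / area U) +i*
  ((\int[leb2]_(p in plane U) p.2) / area U).

Definition complex_measure (U : set C) : C :=
  (area U)%:C * center_of_mass U.

(* H is the principal part of the complex measures of the eps-neighborhoods of
   the h-orbits starting in V. The functions e^2 ln e, e^2, e^(5/2) ln e,
   e^(5/2) form an asymptotic scale, so that the expansion determines q1, q2
   and the values of H on V. *)
Definition principal_part (h : C -> C) (V : set C) (H : C -> C) : Prop :=
  exists q1 q2 : C, forall z, V z ->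
    (fun e : R => Normc.normc
       (complex_measure (eps_nbhd (forward_orbit h z) e)
        - (q1 * (e ^+ 2 * ln e)%:C + H z * (e ^+ 2)%:C
           + q2 * (e `^ (5 / 2) * ln e)%:C)))
    =O_ (0^'+) (fun e : R => e `^ (5 / 2)).

End Definitions.

(* Main.v *)
(* Let h = z + s z^2 + z^3 + O(z^4) with s = 1 (h = f) or s = -1 (h = g). In the
   coordinate -s/z the map becomes zeta |-> zeta + 1 + O(zeta^-2), so every nonzero
   orbit in the petal is asymptotic to -s/n. Splitting off the disc around the
   initial point, which is disjoint from the rest for small e, gives the functional
   equation. For analyticity, cut the e-neighborhood of an orbit into the crescents
   D(p_n,e) \ D(p_{n+1},e), which partition it up to a set in D(0,2e) because the
   orbit turns slowly. The area of a crescent depends only on e and the step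
   p_{n+1} - p_n; comparing two orbits crescent by crescent yields
     H(z) - H(z') = pi sum_n (h^n(z) - h^n(z')).
   This series converges normally near every point of the petal, in the Wiener
   algebra of absolutely convergent power series on a small disc, hence H is
   analytic. *)

(* Only differences of two expansions are used: the terms with [q1] and [q2] cancel, and two
   measures differ by (H z - H z') e^2 + o(e^2). The task is to compute such a difference up to
   o(e^2), although infinitely many crescents come from overlapping discs. Two facts make this
   possible. The total area of the crescents is o(e), so concentrating each one at the center of its
   disc costs o(e^2). And corresponding crescents of two orbits are both full discs while the steps,
   of order 1/n^2, are long compared with e; afterwards their contributions differ by O(e^2 / n^2)
   uniformly in e, so the sum can be cut at a fixed index. A petal is not assumed to avoid 0, where
   no disc splits off. If it contained 0, comparing the one-point orbit of 0 with a nonzero orbit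
   would bound the partial sums of the harmonic series. The Wiener norm is submultiplicative, so the
   power series of all iterates are bounded on one common disc by algebra alone, without Cauchy
   estimates. *)
Require Import Defs.
From mathcomp Require Import all_boot all_order all_algebra.
From mathcomp Require Import complex.
From mathcomp Require Import all_classical all_reals all_analysis.
From mathcomp Require Import measurable_realfun ring lra.

Import Order.TTheory GRing.Theory Num.Theory.
Import numFieldNormedType.Exports.

Local Open Scope classical_set_scope.
Local Open Scope ring_scope.
Local Open Scope complex_scope.
Set Implicit Arguments.
Unset Strict Implicit.
Unset Printing Implicit Defensive.

(** * The modulus with real values *)

Local Notation nc := Normc.normc.
Arguments Normc.normc : simpl never.

Section ComplexModulus.
Variable R : realType.
Implicit Types x y z : R[i].

Lemma nc_ge0 x : 0 <= nc x. Proof. by case: x => a b; exact: sqrtr_ge0. Qed.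

Lemma ncV x : nc x^-1 = (nc x)^-1. Proof. exact: Normc.normcV. Qed.

Lemma ncM x y : nc (x * y) = nc x * nc y. Proof. exact: Normc.normcM. Qed.

Lemma nc0 : nc (0 : R[i]) = 0. Proof. exact: Normc.normc0. Qed.

Lemma nc1 : nc (1 : R[i]) = 1. Proof. exact: Normc.normc1. Qed.

Lemma nc_eq0 x : (nc x == 0) = (x == 0).
Proof. by apply/eqP/eqP => [/Normc.eq0_normc|->] //; rewrite nc0. Qed.

Lemma nc_gt0 x : (0 < nc x) = (x != 0).
Proof. by rewrite lt_def nc_ge0 andbT nc_eq0. Qed.

Lemma ncX x n : nc (x ^+ n) = nc x ^+ n.
Proof. by elim: n => [|n IH]; rewrite ?expr0 ?nc1// !exprS ncM IH. Qed.

Lemma ncB x y : nc (x - y) = nc (y - x).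
Proof. by rewrite -normcN opprB. Qed.

Lemma nc_real (r : R) : nc (r%:C) = `|r|.
Proof. by rewrite /Normc.normc /= expr0n addr0 sqrtr_sqr. Qed.

Lemma nc_triangle y x z : nc (x - z) <= nc (x - y) + nc (y - z).
Proof. by rewrite -(subrKA y x (- z)) le_normcD. Qed.

Lemma nc_subr x y : nc (x - y) <= nc x + nc y.
Proof. by rewrite -[nc y]normcN; exact: le_normcD. Qed.

Lemma nc_sub_ge x y : nc x - nc y <= nc (x - y).
Proof. by have := le_normcD (x - y) y; rewrite subrK; lra. Qed.

Lemma nc_add_ge x y : nc x - nc y <= nc (x + y).
Proof. by have := nc_sub_ge x (- y); rewrite opprK normcN. Qed.

Lemma nc_sum (I : Type) (s : seq I) (P : pred I) (F : I -> R[i]) :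
  nc (\sum_(i <- s | P i) F i) <= \sum_(i <- s | P i) nc (F i).
Proof.
elim/big_ind2 : _ => [|a x b y ax byy|//]; first by rewrite nc0.
by rewrite (le_trans (le_normcD _ _))// lerD.
Qed.

Lemma Re_le_nc x : `|complex.Re x| <= nc x.
Proof.
by case: x => a b /=; rewrite -sqrtr_sqr; apply: ler_wsqrtr; rewrite lerDl sqr_ge0.
Qed.

Lemma Im_le_nc x : `|complex.Im x| <= nc x.
Proof.
by case: x => a b /=; rewrite -sqrtr_sqr; apply: ler_wsqrtr; rewrite lerDr sqr_ge0.
Qed.

Lemma sqr_nc x : nc x ^+ 2 = complex.Re x ^+ 2 + complex.Im x ^+ 2.
Proof. by case: x => a b /=; rewrite sqr_sqrtr// addr_ge0 ?sqr_ge0. Qed.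

Lemma nc_le_ReIm x : nc x <= `|complex.Re x| + `|complex.Im x|.
Proof.
rewrite -(ler_pXn2r (n:=2))// ?nnegrE ?nc_ge0 ?addr_ge0// sqr_nc.
rewrite -[complex.Re x ^+ 2]real_normK ?num_real// -[complex.Im x ^+ 2]real_normK ?num_real//.
have := normr_ge0 (complex.Re x); have := normr_ge0 (complex.Im x); nra.
Qed.

Lemma norm_ltc x (e : R) : (`|x| < e%:C) = (nc x < e).
Proof. by rewrite -[`|x|]/((nc x)%:C) ltcR. Qed.

Lemma norm_lec x (e : R) : (`|x| <= e%:C) = (nc x <= e).
Proof. by rewrite -[`|x|]/((nc x)%:C) lecR. Qed.

End ComplexModulus.

(** * Area and first moment of plane sets *)

Section PlaneMeasure.
Variable R : realType.
Local Notation leb := (@lebesgue_measure R).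
Local Notation leb2 := ((@lebesgue_measure R \x @lebesgue_measure R)%E).
Local Notation RR := (measurableTypeR R * measurableTypeR R)%type.

Lemma lebesgue_measure_shift (a : R) (A : set (measurableTypeR R)) :
  measurable A -> pushforward leb (fun x : measurableTypeR R => x + a : measurableTypeR R) A = leb A.
Proof.
move=> mA; have mf : measurable_fun [set: measurableTypeR R] (fun x : measurableTypeR R => x + a : measurableTypeR R).
  exact: measurable_funD.
apply/esym/lebesgue_measure_unique => //= _ [[c d]] _ <-.
rewrite /pushforward.
have -> : (fun x : R => x + a) @^-1` `]c, d] = `]c - a, d - a]%classic.
  by apply/seteqP; split => x /=; rewrite !in_itv/= ltrBlDr lerBrDr.
rewrite !lebesgue_measure_itv/= !lte_fin ltrD2r.
by case: ifP => // _; rewrite -!EFinB opprD opprK; congr (_%:E); ring.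
Qed.

(** The product measure is determined by its values on rectangles, where the claim is the
    one-dimensional translation invariance in each factor. *)
Lemma leb2_shift (a b : R) (A : set RR) : measurable A ->
  leb2 ((fun p : RR => (p.1 + a, p.2 + b)) @^-1` A) = leb2 A.
Proof.
move=> mA.
have mf : measurable_fun [set: RR] (fun p : RR => (p.1 + a, p.2 + b) : RR).
  by apply: measurable_fun_pair; apply: measurable_funD.
rewrite -[LHS]/(pushforward leb2 (fun p : RR => (p.1 + a, p.2 + b) : RR) A).
apply/esym/product_measure_unique => // X Y mX mY.
rewrite /= /pushforward.
have -> : (fun p : RR => (p.1 + a, p.2 + b)) @^-1` (X `*` Y) =
  ((fun x : measurableTypeR R => x + a) @^-1` X) `*` ((fun x : measurableTypeR R => x + b) @^-1` Y).
  by apply/seteqP; split.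
have mp c Z : measurable Z -> measurable ((fun x : measurableTypeR R => x + c) @^-1` Z).
  move=> mZ; rewrite -[X in measurable X]setTI.
  suff: measurable_fun [set: measurableTypeR R] (fun x : measurableTypeR R => x + c : measurableTypeR R) by exact.
  exact: measurable_funD.
rewrite product_measure1E; [|exact: mp..].
by congr (_ * _)%E; exact: lebesgue_measure_shift.
Qed.

(* Substitute [x = r sin t]. *)
Lemma integral_semicircle (r : R) : 0 < r ->
  (\int[leb]_(x in `[(- r)%R, r]) (2 * Num.sqrt (r ^+ 2 - x ^+ 2))%R%:E = (pi * r ^+ 2)%R%:E)%E.
Proof.
move=> r0.
pose F (t : R) := r * sin t.
have dF (t : R) : is_derive t (1 : R) F (r * cos t).
  exact: (@is_deriveZ _ _ _ sin r t 1 _ (is_derive_sin t)).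
have F'E : derive1 F = fun t => r * cos t.
  by apply/funext => t; rewrite derive1E; apply: derive_val.
have cF' : continuous (fun t : R => r * cos t).
  by move=> t; apply: cvgM; [exact: cvg_cst|exact: continuous_cos].
have cF : continuous F.
  by move=> t; apply: cvgM; [exact: cvg_cst|exact: continuous_sin].
have pi0 := pi_gt0 R.
have := @integration_by_substitution_increasing R F (fun x => 2 * Num.sqrt (r ^+ 2 - x ^+ 2)) (- (pi / 2)) (pi / 2).
have -> : F (- (pi / 2)) = - r by rewrite /F sinN sin_pihalf mulrN1.
have -> : F (pi / 2) = r by rewrite /F sin_pihalf mulr1.
rewrite F'E => -> //; last 6 first.
- lra.
- by move=> x y xI yI xy; rewrite /F ltr_pM2l// ltr_sin.
- by apply/cvg_ex; exists (r * cos (- (pi / 2))); apply: cvg_at_right_filter; exact: cF'.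
- by apply/cvg_ex; exists (r * cos (pi / 2)); apply: cvg_at_left_filter; exact: cF'.
- split; first by move=> x _; exact: ex_derive.
  + by apply: cvg_at_right_filter; exact: cF.
  + by apply: cvg_at_left_filter; exact: cF.
- apply: continuous_subspaceT => x; apply: cvgM; first exact: cvg_cst.
  apply: (@continuous_comp _ _ _ (fun x : R => r ^+ 2 - x ^+ 2) Num.sqrt); last exact: sqrt_continuous.
  by apply: cvgB; [exact: cvg_cst|exact: exprn_continuous].
(* An antiderivative of 2 (r cos t)^2, the integrand after substitution. *)
pose G (t : R) := r ^+ 2 * (t + sin t * cos t).
have dG (t : R) : is_derive t (1 : R) G (r ^+ 2 * (2 * cos t ^+ 2)).

  have := @is_deriveM _ _ sin cos t 1 _ _ (is_derive_sin t) (is_derive_cos t) => dsc.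
  have := @is_deriveZ _ _ _ _ (r ^+ 2) _ _ _ (is_deriveD (@is_derive_id _ _ t (1 : R)) dsc).
  move=> /is_derive_eq; apply; rewrite /GRing.scale/=; have := cos2Dsin2 t; nra.
transitivity (\int[leb]_(x in `[(- (pi / 2))%R, (pi / 2)%R]) ((r ^+ 2 * (2 * cos x ^+ 2))%R%:E))%E.
  apply: eq_integral => x; rewrite inE/= in_itv/= => /andP[x1 x2].
  congr (_%:E); rewrite !fctE /= /F.
  have c0 : 0 <= cos x by apply: cos_ge0_pihalf; rewrite x1.
  have -> : r ^+ 2 - (r * sin x) ^+ 2 = (r * cos x) ^+ 2.
    by have := cos2Dsin2 x; nra.
  rewrite sqrtr_sqr ger0_norm ?mulr_ge0 ?(ltW r0)//; ring.
rewrite (@continuous_FTC2 _ _ G).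
- by rewrite /G sinN cosN cos_pihalf -EFinB; congr (_%:E); lra.
- lra.
- apply: continuous_subspaceT => x; apply: cvgM; first exact: cvg_cst.
  apply: cvgM; first exact: cvg_cst.
  apply: (@continuous_comp _ _ _ cos (fun x : R => x ^+ 2)); last exact: exprn_continuous.
  exact: continuous_cos.
- have cG : continuous G by move=> x; apply/differentiable_continuous/derivable1_diffP/ex_derive.
  split; first by move=> x _; exact: ex_derive.
  + by apply: cvg_at_right_filter; exact: cG.
  + by apply: cvg_at_left_filter; exact: cG.
- by move=> x _; rewrite derive1E; apply: derive_val.
Qed.

Definition disc (c : R[i]) (e : R) : set R[i] := [set w | nc (w - c) < e].

Lemma plane_discE (c : R[i]) (e : R) : 0 < e -> plane (disc c e) =
  [set p : R * R | (p.1 - complex.Re c) ^+ 2 + (p.2 - complex.Im c) ^+ 2 < e ^+ 2].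
Proof.
move=> e0; apply/seteqP; split => -[x y]; case: c => a b; rewrite /plane /disc /= => h.
  have s0 : 0 <= (x - a) ^+ 2 + (y - b) ^+ 2 by rewrite addr_ge0 ?sqr_ge0.
  by rewrite -(sqr_sqrtr s0) ltr_pXn2r// ?nnegrE ?sqrtr_ge0 ?ltW.
by rewrite -(ltr_pXn2r (n:=2))// ?nnegrE ?sqrtr_ge0 ?(ltW e0)// sqr_sqrtr// addr_ge0 ?sqr_ge0.
Qed.

Lemma measurable_plane_disc (c : R[i]) (e : R) : 0 < e ->
  measurable (plane (disc c e) : set RR).
Proof.
move=> e0; rewrite plane_discE//.
pose f (p : RR) : measurableTypeR R := (p.1 - complex.Re c) ^+ 2 + (p.2 - complex.Im c) ^+ 2.
have mf : measurable_fun [set: RR] f.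
  by apply: measurable_funD; apply: measurable_funX; apply: measurable_funB.
have := mf measurableT `]-oo, e ^+ 2[%classic (measurable_itv _).
by rewrite setTI; congr (measurable _).
Qed.

Lemma leb2_disc0 (e : R) : 0 < e -> leb2 (plane (disc 0 e)) = (pi * e ^+ 2)%:E.
Proof.
move=> e0; rewrite -integral_semicircle// /product_measure1 [RHS]integral_mkcond.
apply: eq_integral => x _ /=.
have xsE : xsection (plane (disc 0 e)) x =
    `](- Num.sqrt (e ^+ 2 - x ^+ 2)), Num.sqrt (e ^+ 2 - x ^+ 2)[%classic.
  rewrite plane_discE//; apply/seteqP; split => y; rewrite /xsection/= inE/= !subr0 in_itv/=.
    move=> h; have s0 : 0 < e ^+ 2 - x ^+ 2 by have := sqr_ge0 y; lra.
    rewrite -ltr_norml -(ltr_pXn2r (n:=2))// ?nnegrE ?sqrtr_ge0// sqr_sqrtr ?ltW//.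
    rewrite real_normK ?num_real//; lra.
  (* Off the disc the square root of a nonpositive number is 0, and the interval is empty as
     required. *)
  case: (lerP (e ^+ 2 - x ^+ 2) 0) => s0.
    by rewrite ler0_sqrtr//; lra.
  rewrite -ltr_norml -(ltr_pXn2r (n:=2))// ?nnegrE ?sqrtr_ge0// sqr_sqrtr ?ltW//.
  rewrite real_normK ?num_real//; lra.
rewrite xsE lebesgue_measure_itv/= lte_fin patchE.
have s0 := sqrtr_ge0 (e ^+ 2 - x ^+ 2).
case: ifPn => h1; case: ifPn => h2.
- by rewrite -EFinB; congr (_%:E); lra.
- exfalso; move: h2; rewrite notin_setE/= in_itv/=; apply.
  have s1 : 0 < Num.sqrt (e ^+ 2 - x ^+ 2) by lra.
  rewrite sqrtr_gt0 in s1.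
  by rewrite -ler_norml -(ler_pXn2r (n:=2))// ?nnegrE ?(ltW e0)// real_normK ?num_real//; lra.
- by congr (_%:E); move: h1; rewrite -leNgt; lra.
- by [].
Qed.

Definition bounded_measurable (U : set R[i]) :=
  measurable (plane U : set RR) /\ exists (c : R[i]) (e : R), 0 < e /\ U `<=` disc c e.

Lemma planeS (U V : set R[i]) : U `<=` V -> plane U `<=` plane V.
Proof. by move=> UV p; exact: UV. Qed.

Lemma leb2_disc (c : R[i]) (e : R) : 0 < e -> leb2 (plane (disc c e)) = (pi * e ^+ 2)%:E.
Proof.
move=> e0; have := leb2_disc0 e0.
rewrite -(leb2_shift (- complex.Re c) (- complex.Im c)); last exact: measurable_plane_disc.
move=> <-; congr (leb2 _); rewrite !plane_discE//; apply/seteqP; split => p /=; by rewrite !subr0.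
Qed.

Lemma bounded_measurable_disc (c : R[i]) (e : R) : 0 < e -> bounded_measurable (disc c e).
Proof. by move=> e0; split; [exact: measurable_plane_disc|exists c, e; split]. Qed.

Lemma area_disc (c : R[i]) (e : R) : 0 < e -> area (disc c e) = pi * e ^+ 2.
Proof. by move=> e0; rewrite /area leb2_disc. Qed.

Lemma bounded_leb2_fin (U : set R[i]) : bounded_measurable U ->
  (leb2 (plane U) < +oo)%E.
Proof.
move=> [mU [c [e [e0 Ue]]]].
apply: (@le_lt_trans _ _ (leb2 (plane (disc c e)))); last by rewrite leb2_disc// ltry.
by apply: le_measure; rewrite ?inE//; [exact: measurable_plane_disc|exact: planeS].
Qed.

Lemma leb2_area (U : set R[i]) : bounded_measurable U -> leb2 (plane U) = (area U)%:E.
Proof. by move=> bU; rewrite /area fineK// ge0_fin_numE// bounded_leb2_fin. Qed.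

Lemma area_ge0 (U : set R[i]) : 0 <= area U.
Proof. by rewrite /area fine_ge0. Qed.

Lemma area_le (U V : set R[i]) : bounded_measurable U -> bounded_measurable V ->
  U `<=` V -> area U <= area V.
Proof.
move=> bU bV UV; rewrite -lee_fin -!leb2_area//.
by apply: le_measure; rewrite ?inE//; [exact: bU.1|exact: bV.1|exact: planeS].
Qed.

Lemma bounded_measurableU (U V : set R[i]) :
  bounded_measurable U -> bounded_measurable V -> bounded_measurable (U `|` V).
Proof.
move=> [mU [c [e [e0 Ue]]]] [mV [d [f [f0 Vf]]]]; split; first exact: measurableU.
exists c, (e + (nc (d - c) + f)); split.
  by have := nc_ge0 (d - c); lra.
move=> w [/Ue|/Vf]; rewrite /disc/= => h; first by have := nc_ge0 (d - c); lra.
have -> : w - c = (d - c) + (w - d) by ring.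
by have := le_normcD (d - c) (w - d); lra.
Qed.

Lemma bounded_measurableD (U V : set R[i]) :
  bounded_measurable U -> bounded_measurable V -> bounded_measurable (U `\` V).
Proof.
move=> [mU [c [e [e0 Ue]]]] [mV _]; split; first exact: measurableD.
by exists c, e; split => // w [/Ue].
Qed.

Lemma areaU (U V : set R[i]) : bounded_measurable U -> bounded_measurable V ->
  U `&` V = set0 -> area (U `|` V) = area U + area V.
Proof.
move=> bU bV UV; have bUV := bounded_measurableU bU bV.
apply: EFin_inj; rewrite EFinD -!leb2_area//.
apply: measureU; [exact: bU.1|exact: bV.1|].
by rewrite -[LHS]/(plane (U `&` V)) UV.
Qed.

Lemma area_shift (c : R[i]) (U : set R[i]) : measurable (plane U : set RR) ->
  area [set w | U (w - c)] = area U.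
Proof.
move=> mU; rewrite /area -[in RHS](leb2_shift (- complex.Re c) (- complex.Im c))//.
by congr (fine (leb2 _)); apply/seteqP; split => -[x y]; case: c.
Qed.

(** Without the division by the area this is additive on disjoint unions; it agrees with
    [complex_measure] on bounded measurable sets. *)
Definition first_moment (U : set R[i]) : R[i] :=
  (\int[leb2]_(p in plane U) p.1) +i* (\int[leb2]_(p in plane U) p.2).

Lemma integrable_coord (U : set R[i]) : bounded_measurable U ->
  leb2.-integrable (plane U) (EFin \o fst) /\ leb2.-integrable (plane U) (EFin \o snd).
Proof.
move=> bU; have Ufin := bounded_leb2_fin bU; case: bU => mU [c [e [e0 Ue]]].
split; apply: measurable_bounded_integrable => //.
- exact: measurable_funTS.
- exists (`|complex.Re c| + e); split; first exact: num_real.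
  move=> M hM [x y] /Ue; rewrite /disc/= => h; case: c Ue h hM => a b Ue h hM.
  have := ler_normD (x - a) a; rewrite subrK.
  by have := Re_le_nc ((x - a) +i* (y - b)); move: h hM => /=; lra.
- exact: measurable_funTS.
- exists (`|complex.Im c| + e); split; first exact: num_real.
  move=> M hM [x y] /Ue; rewrite /disc/= => h; case: c Ue h hM => a b Ue h hM.
  have := ler_normD (y - b) b; rewrite subrK.
  by have := Im_le_nc ((x - a) +i* (y - b)); move: h hM => /=; lra.
Qed.

Lemma first_momentU (U V : set R[i]) : bounded_measurable U -> bounded_measurable V ->
  U `&` V = set0 -> first_moment (U `|` V) = first_moment U + first_moment V.
Proof.
move=> bU bV UV; have [i1 i2] := integrable_coord (bounded_measurableU bU bV).
have dUV : [disjoint plane U & plane V].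
  by apply/eqP; rewrite -[LHS]/(plane (U `&` V)) UV.
rewrite /first_moment -[plane (U `|` V)]/(plane U `|` plane V).
rewrite !Rintegral_setU//; [exact: bU.1|exact: bV.1|exact: bU.1|exact: bV.1].
Qed.

Lemma Rintegral_sub_cst (U : set R[i]) (h : RR -> R) (a e : R) :
  bounded_measurable U -> leb2.-integrable (plane U) (EFin \o h) ->
  (forall p, plane U p -> `|h p - a| <= e) ->
  `|\int[leb2]_(p in plane U) h p - area U * a| <= e * area U.
Proof.
move=> bU ih he; have mU := bU.1.
have ic (b : R) : leb2.-integrable (plane U) (EFin \o cst b).
  apply: measurable_bounded_integrable => //; first exact: bounded_leb2_fin.
  by exists `|b|; split; [exact: num_real|move=> M /ltW bM x _].
rewrite [area U * a]mulrC -[a * area U](Rintegral_cst leb2 mU).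
rewrite -RintegralB//; last exact: ic.
rewrite -[e * area U](Rintegral_cst leb2 mU).
have ihc : leb2.-integrable (plane U) (EFin \o (fun p => h p - a)).
  by have := integrableB mU ih (ic a).
apply: (le_trans (le_normr_Rintegral mU ihc)).
apply: le_Rintegral => //; last exact: ic.
by have := integrable_norm ihc.
Qed.

(** Each coordinate contributes an error e times the area; the factor 2 comes from bounding the
    modulus by the sum of the two. *)
Lemma first_moment_bound (U : set R[i]) (c : R[i]) (e : R) :
  bounded_measurable U -> (forall w, U w -> nc (w - c) <= e) ->
  nc (first_moment U - (area U)%:C * c) <= 2 * e * area U.
Proof.
move=> bU Ue; have [i1 i2] := integrable_coord bU.
apply: (le_trans (nc_le_ReIm _)).
have -> : 2 * e * area U = e * area U + e * area U by ring.
case: c Ue => a b Ue; rewrite /first_moment /= !mul0r subr0 addr0; apply: lerD.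
  apply: Rintegral_sub_cst => // -[x y] /Ue h.
  by apply: (le_trans (Re_le_nc _) h).
apply: Rintegral_sub_cst => // -[x y] /Ue h.
by apply: (le_trans (Im_le_nc _) h).
Qed.

Lemma complex_measureE (U : set R[i]) : bounded_measurable U ->
  complex_measure U = first_moment U.
Proof.
move=> bU; rewrite /complex_measure /center_of_mass /first_moment.
have [A0|A0] := eqVneq (area U) 0.
  (* For area 0 the left side is 0 because of the factor [area U], so the moment must be shown to
     vanish too. *)
  have [c [e [e0 Ue]]] := bU.2.
  have : nc (first_moment U - (area U)%:C * c) <= 2 * e * area U.
    by apply: first_moment_bound => // w /Ue /ltW.
  rewrite A0 mulr0 mul0r subr0 => h.
  have : first_moment U = 0 by apply/eqP; rewrite -nc_eq0 eq_le h nc_ge0.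
  by rewrite /first_moment => ->; rewrite mul0r.
by rewrite /real_complex_def; simpc; rewrite ![area U * (_ / area U)]mulrC !divfK.
Qed.

End PlaneMeasure.

(** * Neighborhoods of orbits cut into crescents *)

Section Crescents.
Variable R : realType.
Implicit Types (c d : R[i]) (e : R).

Definition crescent e d : R := area (disc 0 e `\` disc d e).

Lemma bounded_crescent (e : R) c d : 0 < e -> bounded_measurable (disc c e `\` disc d e).
Proof. by move=> e0; apply: bounded_measurableD; exact: bounded_measurable_disc. Qed.

Lemma area_crescent (e : R) c d : 0 < e ->
  area (disc c e `\` disc d e) = crescent e (d - c).
Proof.
move=> e0; rewrite /crescent -(area_shift c (bounded_crescent 0 (d - c) e0).1).
congr (area _); apply/seteqP; split => w; rewrite /disc/= subr0.
  by rewrite opprB addrA subrK.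
by rewrite opprB addrA subrK.
Qed.

Lemma crescent_ge0 (e : R) d : 0 <= crescent e d.
Proof. exact: area_ge0. Qed.

Lemma crescent_le (e : R) d : 0 < e -> crescent e d <= pi * e ^+ 2.
Proof.
move=> e0; rewrite -(area_disc 0 e0); apply: area_le.
- exact: bounded_crescent.
- exact: bounded_measurable_disc.
- by move=> w [].
Qed.

Lemma crescent_far (e : R) d : 0 < e -> 2 * e <= nc d -> crescent e d = pi * e ^+ 2.
Proof.
move=> e0 ed; rewrite -(area_disc 0 e0) /crescent; congr (area _).
apply/seteqP; split => w; first by case.
rewrite /disc/= subr0 => wd; split => // wd'.
by have := nc_triangle w d 0; rewrite !subr0 ncB; lra.
Qed.

(* The difference of two discs of radius [e] lies in an annulus whose width is
   the distance of the centers. *)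
Lemma area_discD (e : R) c d : 0 < e -> area (disc c e `\` disc d e) <= 3 * pi * e * nc (c - d).
Proof.
move=> e0; have pi0 := pi_gt0 R; have cd0 := nc_ge0 (c - d).
(* With t the distance of the centers, the annulus has area pi (2 e t + t^2), at most 3 pi e t if t
   <= e. For larger t the full disc, of area pi e^2, is already small enough. *)
have [le|lt] := lerP (nc (c - d)) e; last first.
  rewrite area_crescent//; apply: (le_trans (crescent_le _ e0)).
  have : e * e <= e * nc (c - d) by rewrite ler_pM2l// ltW.
  have : 0 <= e * nc (c - d) by rewrite mulr_ge0// ltW.
  by rewrite expr2; nra.
have h0 : 0 < e + nc (c - d) by lra.
have bC := bounded_crescent c d e0.
have : area (disc d (e + nc (c - d))) = pi * (e + nc (c - d)) ^+ 2 by rewrite area_disc.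
have : area (disc c e `\` disc d e) + area (disc d e) <= area (disc d (e + nc (c - d))).
  rewrite -areaU//; last first.
  - by apply/seteqP; split => // w [[_]].
  - exact: bounded_measurable_disc.
  apply: area_le.
  - by apply: bounded_measurableU => //; exact: bounded_measurable_disc.
  - exact: bounded_measurable_disc.
  - move=> w [[]|]; rewrite /disc/=; last by lra.
    by move=> h _; have := nc_triangle c w d; lra.
rewrite area_disc// => h1 h2; rewrite h2 in h1.
have : 0 <= pi * (nc (c - d) * (e - nc (c - d))) by rewrite !mulr_ge0 ?subr_ge0// ltW.
by lra.
Qed.

(** Triangle inequality for set differences: D(0) minus D(d) is covered by D(0) minus D(d') and
    D(d') minus D(d), and [area_discD] bounds the latter. *)
Lemma crescent_lip (e : R) d d' : 0 < e ->
  `|crescent e d - crescent e d'| <= 3 * pi * e * nc (d - d').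
Proof.
move=> e0; wlog le : d d' / crescent e d' <= crescent e d.
  move=> H; have /orP[/H//|/H] := le_total (crescent e d') (crescent e d).
  by rewrite distrC (ncB d' d).
rewrite ger0_norm ?subr_ge0//.
have : area (disc 0 e `\` disc d e) <=
    area ((disc 0 e `\` disc d' e) `|` (disc d' e `\` disc d e)).
  apply: area_le.
  - exact: bounded_crescent.
  - by apply: bounded_measurableU; exact: bounded_crescent.
  - by move=> w [h1 h2]; have [h|h] := pselect (disc d' e w); [right|left].
rewrite areaU; [|exact: bounded_crescent|exact: bounded_crescent|]; last first.
  by apply/seteqP; split => // w [[_ h] []].
move=> h; rewrite lerBlDl (ncB d d'); apply: (le_trans h).
by rewrite lerD2l; exact: area_discD.
Qed.

Lemma crescent_le_dist (e : R) d : 0 < e -> crescent e d <= 3 * pi * e * nc d.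
Proof.
move=> e0; rewrite /crescent; have := area_discD 0 d e0.
by rewrite sub0r normcN.
Qed.

End Crescents.

(** * Crescent decomposition of the first moment *)

Section TailNeighborhoods.
Variable R : realType.
Implicit Types (p : nat -> R[i]) (e : R).

Definition tail_nbhd p e n : set R[i] := [set w | exists2 m, (n <= m)%N & nc (w - p m) < e].

(** A point of disc n that lies in any later disc lies already in the next one. This makes crescent
    n disjoint from everything that follows it. *)
Definition nested p e := forall n m w, (n < m)%N ->
  nc (w - p n) < e -> nc (w - p m) < e -> nc (w - p n.+1) < e.

Lemma bounded_tail_nbhd p e n r : 0 < e -> (forall m, nc (p m) <= r) ->
  bounded_measurable (tail_nbhd p e n).
Proof.
move=> e0 pr; split; last first.
  exists 0, (e + r); split; first by have := pr 0%N; have := nc_ge0 (p 0%N); lra.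
  move=> w [m _ h]; rewrite /disc/= subr0.
  by have := le_normcD (w - p m) (p m); rewrite subrK; have := pr m; lra.
have -> : plane (tail_nbhd p e n) = \bigcup_(m in [set m | (n <= m)%N]) plane (disc (p m) e).
  by apply/seteqP; split => -[x y] [m nm h]; exists m.
by apply: bigcup_measurable => m _; exact: measurable_plane_disc.
Qed.

Lemma tail_nbhd_split p e n : nested p e ->
  tail_nbhd p e n = (disc (p n) e `\` disc (p n.+1) e) `|` tail_nbhd p e n.+1.
Proof.
move=> np; apply/seteqP; split => w.
  move=> [m nm h]; have [nm'|] := ltnP n m; first by right; exists m.
  move=> mn; have {}mn : m = n by apply/eqP; rewrite eqn_leq nm mn.
  subst m; have [h'|h'] := pselect (disc (p n.+1) e w); last by left.
  by right; exists n.+1.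
by move=> [[h _]|[m nm h]]; [exists n|exists m => //; exact: ltnW].
Qed.

Lemma tail_nbhd_disjoint p e n : nested p e ->
  (disc (p n) e `\` disc (p n.+1) e) `&` tail_nbhd p e n.+1 = set0.
Proof.
move=> np; apply/seteqP; split => // w [[h1 h2] [m nm h3]].
by apply: h2; exact: np h3.
Qed.

Lemma first_moment_tail p e P r : 0 < e -> (forall m, nc (p m) <= r) -> nested p e ->
  first_moment (tail_nbhd p e 0) =
  \sum_(n < P) first_moment (disc (p n) e `\` disc (p n.+1) e)
  + first_moment (tail_nbhd p e P).
Proof.
move=> e0 pr np; elim: P => [|P ->]; first by rewrite big_ord0 add0r.
rewrite big_ord_recr /= -addrA; congr (_ + _).
rewrite {1}tail_nbhd_split// first_momentU//.
- exact: bounded_crescent.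
- exact: bounded_tail_nbhd pr.
- exact: tail_nbhd_disjoint.
Qed.

(** The remainder from index P on lies in D(0, 2 e), so its area is at most 4 pi e^2 and its moment
    at most 2 (2 e) (4 pi e^2) = 16 pi e^3. *)
Lemma complex_measure_tail p e P r : 0 < e -> (forall m, nc (p m) <= r) -> nested p e ->
  (forall m, (P <= m)%N -> nc (p m) <= e) ->
  nc (complex_measure (tail_nbhd p e 0) -
      \sum_(n < P) (crescent e (p n.+1 - p n))%:C * p n)
  <= 2 * e * \sum_(n < P) crescent e (p n.+1 - p n) + 16 * pi * e ^+ 3.
Proof.
move=> e0 pr np pP; rewrite complex_measureE; last exact: bounded_tail_nbhd pr.
rewrite (first_moment_tail P e0 pr np) addrAC -sumrB.
apply: (le_trans (le_normcD _ _)); apply: lerD.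
  apply: (le_trans (nc_sum _ _ _)); rewrite mulr_sumr; apply: ler_sum => n _.
  rewrite -area_crescent//; apply: first_moment_bound; first exact: bounded_crescent.
  by move=> w [/ltW].
have bT := bounded_tail_nbhd P e0 pr.
have e20 : 0 < 2 * e by lra.
have T2 w : tail_nbhd p e P w -> nc (w - 0) < 2 * e.
  move=> [m Pm h]; rewrite subr0; have := le_normcD (w - p m) (p m); rewrite subrK.
  by have := pP m Pm; lra.
have := first_moment_bound bT (fun w h => ltW (T2 w h)).
rewrite mulr0 subr0 => /le_trans; apply.
have : area (tail_nbhd p e P) <= pi * (2 * e) ^+ 2.
  by rewrite -(area_disc 0 e20); apply: area_le => //; exact: bounded_measurable_disc.
have := pi_gt0 R; nra.
Qed.

End TailNeighborhoods.

(** * Nestedness of discs along a slowly turning orbit *)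

Section Nestedness.
Variable R : realType.
Implicit Types (p : nat -> R[i]) (e r : R).

Lemma cReM (x y : R[i]) : complex.Re (x * y) =
  complex.Re x * complex.Re y - complex.Im x * complex.Im y.
Proof. by case: x y => a b [c d]. Qed.

Lemma cImM (x y : R[i]) : complex.Im (x * y) =
  complex.Re x * complex.Im y + complex.Im x * complex.Re y.
Proof. by case: x y => a b [c d]. Qed.

Lemma cReD (x y : R[i]) : complex.Re (x + y) = complex.Re x + complex.Re y.
Proof. by case: x y => a b [c d]. Qed.

Lemma cImD (x y : R[i]) : complex.Im (x + y) = complex.Im x + complex.Im y.
Proof. by case: x y => a b [c d]. Qed.

Lemma cReN (x : R[i]) : complex.Re (- x) = - complex.Re x.
Proof. by case: x. Qed.

Lemma cImN (x : R[i]) : complex.Im (- x) = - complex.Im x.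
Proof. by case: x. Qed.

Lemma nc_le_sqr (x y : R[i]) : (nc x <= nc y) = (nc x ^+ 2 <= nc y ^+ 2).
Proof. by rewrite ler_pXn2r// ?nnegrE nc_ge0. Qed.

(** Both sides are the real part of a + b - 2 w times the conjugate of b - a. *)
Lemma sqr_dist_step (w a b : R[i]) : b != a ->
  nc (w - b) ^+ 2 - nc (w - a) ^+ 2 =
  nc (b - a) ^+ 2 * complex.Re ((a + b - 2 * w) / (b - a)).
Proof.
rewrite -subr_eq0 => ba0; set q := (_ / _).
have : q * (b - a) = a + b - 2 * w by rewrite divfK.
rewrite !sqr_nc; case: q => q1 q2; case: w => x y; case: b ba0 => b1 b2 _; case: a => a1 a2 /=.
by simpc => -[h1 h2] /=; nra.
Qed.

(* [|w - p k|] is quasiconvex in [k]: with [q k = (p k + p k.+1 - 2 w) / D k],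
   the sign of [|w - p k.+1|^2 - |w - p k|^2] is that of [Re (q k)], and
   [q k.+1 = rho (q k + 1) + 1] with [rho = D k / D k.+1] almost real. *)
Lemma nested_of_slow_turning p e r C : (forall n, p n.+1 != p n) ->
  (forall n, nc (p n) <= r) -> 0 <= C -> C * (4 * r + 2 * e) < 1 ->
  (forall n, let rho := (p n.+1 - p n) / (p n.+2 - p n.+1) in
     0 <= complex.Re rho /\ `|complex.Im rho| <= C * nc (p n.+1 - p n)) ->
  nested p e.
Proof.
move=> pS pr C0 Cre prho n m w nm wn wm.
rewrite ltNge; apply/negP => wn1.
pose q k := (p k + p k.+1 - 2 * w) / (p k.+1 - p k).
have qS k : (n <= k)%N -> 0 <= complex.Re (q k) -> 0 <= complex.Re (q k.+1).
  move=> nk q0; have [] := prho k.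
  set rho := (_ / _) => rho0 rhoI.
  have d0 : p k.+1 - p k != 0 by rewrite subr_eq0.
  have d1 : p k.+2 - p k.+1 != 0 by rewrite subr_eq0.
  have -> : q k.+1 = rho * (q k + 1) + 1.
    by rewrite /q /rho; field; rewrite d0 d1.
  have qk : nc (q k) * nc (p k.+1 - p k) <= 4 * r + 2 * e.
    rewrite -ncM /q divfK//.
    have wr : nc w <= r + e.
      by have := le_normcD (w - p n) (p n); rewrite subrK; have := pr n; lra.
    have := nc_subr (p k + p k.+1) (2 * w); rewrite ncM.
    have -> : nc (2 : R[i]) = 2.
      by have := nc_real (2 : R); rewrite ger0_norm// => <-; rewrite rmorph_nat.
    by have := le_normcD (p k) (p k.+1); have := pr k; have := pr k.+1; lra.
  rewrite !cReD cReM cReD cImD/= addr0.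
  have h1 : 0 <= complex.Re rho * (complex.Re (q k) + 1) by rewrite mulr_ge0// addr_ge0.
  (* The only term of Re (q k.+1) that can be negative; the final + 1 of the recurrence absorbs it.
     The turning bound contributes the step length, which cancels the denominator of [q k]. *)
  have : `|complex.Im rho * complex.Im (q k)| <= 1.
    rewrite normrM; apply: (@le_trans _ _ (C * nc (p k.+1 - p k) * nc (q k))).
      by apply: ler_pM => //; exact: Im_le_nc.
    rewrite -mulrA [X in C * X]mulrC.
    by apply: (le_trans _ (ltW Cre)); rewrite ler_wpM2l.
  by move/ler_normlP => [_]; lra.
(* Argument by contradiction: w left the disc between n and n + 1, so its distance increased there;
   by [qS] it never decreases later, against [wm]. *)
have qn : 0 <= complex.Re (q n).
  have : nc (w - p n) ^+ 2 < nc (w - p n.+1) ^+ 2.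
    by rewrite ltr_pXn2r// ?nnegrE ?nc_ge0//; lra.
  rewrite -subr_gt0 sqr_dist_step// pmulr_rgt0; first by move/ltW.
  by rewrite exprn_gt0// nc_gt0 subr_eq0.
have qk k : (n <= k)%N -> 0 <= complex.Re (q k).
  elim: k => [|k IH]; first by rewrite leqn0 => /eqP <-.
  by rewrite leq_eqVlt => /predU1P[<-//|nk]; apply: qS => //; exact: IH.
have ak k : (n < k)%N -> e <= nc (w - p k).
  elim: k => [//|k IH]; rewrite ltnS leq_eqVlt => /predU1P[<-//|nk].
  apply: (le_trans (IH nk)); rewrite nc_le_sqr -subr_ge0 sqr_dist_step//.
  by rewrite mulr_ge0 ?exprn_ge0 ?nc_ge0// qk// ltnW.
by have := ak m nm; lra.
Qed.

End Nestedness.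

(** * Comparison of orbit neighborhoods at order e^2 *)

Section OrbitMeasure.
Variable R : realType.
Implicit Types (p q : nat -> R[i]) (e : R).

(** The reference size of the steps, of order 1/n^2, in a form whose sums telescope. *)
Definition omega (n : nat) : R := (n.+1%:R * n.+2%:R)^-1.

Lemma omega_gt0 n : 0 < omega n.
Proof. by rewrite invr_gt0 mulr_gt0// ltr0n. Qed.

Lemma omegaE n : omega n = n.+1%:R^-1 - n.+2%:R^-1.
Proof.
rewrite /omega; have a0 : (n.+1%:R : R) != 0 by rewrite pnatr_eq0.
have b0 : (n.+2%:R : R) != 0 by rewrite pnatr_eq0.
have e : (n.+2%:R : R) = n.+1%:R + 1 by rewrite -natr1.
rewrite {}e in b0 *; move: (n.+1%:R : R) a0 b0 => x a0 b0; field.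
by rewrite a0 b0.
Qed.

Lemma sum_omega N P : \sum_(N <= n < P) omega n <= N.+1%:R^-1.
Proof.
have [NP|/ltnW PN] := leqP N P; last by rewrite big_geq// invr_ge0.
have -> : \sum_(N <= n < P) omega n = N.+1%:R^-1 - P.+1%:R^-1.
  under eq_bigr do rewrite omegaE -opprB.
  by rewrite sumrN telescope_sumr// opprB.
by rewrite gerBl invr_ge0.
Qed.

Lemma sqr_inv_le_omega n : n.+1%:R^-1 ^+ 2 <= 2 * omega n.
Proof.
have x1 : (1 : R) <= n.+1%:R by rewrite ler1n.
rewrite /omega -[n.+2%:R]natr1; move: (n.+1%:R : R) x1 => x x1.
by rewrite exprVn -[2]invrK -invfM lef_pV2 ?posrE; nra.
Qed.

Lemma inv_nat_small (c eta : R) : 0 < eta ->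
  exists N, forall n, (N <= n)%N -> c * n.+1%:R^-1 <= eta.
Proof.
move=> eta0; exists (Num.bound (c / eta)) => n Nn.
rewrite ler_pdivrMr ?ltr0n// mulrC -ler_pdivrMr//.
have [c0|/ltW c0] := lerP 0 c; last first.
  by apply: (@le_trans _ _ 0); rewrite // mulr_le0_ge0// invr_ge0 ltW.
apply: (le_trans (ltW (archi_boundP _))); first by rewrite mulr_ge0// invr_ge0 ltW.
by rewrite ler_nat (leq_trans Nn).
Qed.

(* Satisfied by the tails of orbits asymptotic to [1/n] or [-1/n]. *)
Definition harmonic_orbit p (b B : R) := [/\ 0 < b, 0 <= B,
  forall n, nc (p n) <= B * n.+1%:R^-1,
  forall n, b * omega n <= nc (p n.+1 - p n) <= B * omega n &
  exists2 e0, 0 < e0 & forall e, 0 < e < e0 -> nested p e].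

Section Cells.
Variables (p : nat -> R[i]) (b B : R).
Hypothesis hp : harmonic_orbit p b B.
Local Notation cell e n := (crescent e (p n.+1 - p n)).

(** The first N crescents are bounded by full discs, the others by the Lipschitz estimate. As N is
    free, the total area is o(e), uniformly in P. *)
Lemma sum_cell_le e N P : 0 < e -> (N <= P)%N ->
  \sum_(0 <= n < P) cell e n <= N%:R * (pi * e ^+ 2) + 3 * pi * e * B * N.+1%:R^-1.
Proof.
move=> e0 NP; have [b0 B0 _ pD _] := hp; have pi0 := pi_gt0 R.
rewrite (@big_cat_nat _ _ _ N)//=; apply: lerD.
  apply: (@le_trans _ _ (\sum_(0 <= n < N) (pi * e ^+ 2))).
    by apply: ler_sum => n _; exact: crescent_le.
  by rewrite sumr_const_nat subn0 mulr_natl.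
apply: (@le_trans _ _ (\sum_(N <= n < P) 3 * pi * e * B * omega n)).
  apply: ler_sum => n _; apply: (le_trans (crescent_le_dist _ e0)).
  rewrite -[X in _ <= X]mulrA ler_pM2l; last by rewrite !mulr_gt0.
  by have /andP[] := pD n.
by rewrite -mulr_sumr ler_wpM2l ?sum_omega// !mulr_ge0// ltW.
Qed.

Lemma complex_measure_cells (eta : R) : 0 < eta -> exists2 delta, 0 < delta &
  forall e, 0 < e < delta -> exists P0, forall P, (P0 <= P)%N ->
  nc (complex_measure (tail_nbhd p e 0) - \sum_(0 <= n < P) (cell e n)%:C * p n)
  <= eta * e ^+ 2.
Proof.
move=> eta0; have [b0 B0 pB pD [e0 e00 npe]] := hp; have pi0 := pi_gt0 R.
have [N1 /(_ _ (leqnn _)) hN] := @inv_nat_small (6 * pi * B) (eta / 3) ltac:(lra).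
have N0 := ler0n R N1.
(* [e0] gives nestedness. The other two bounds make the first [N1] crescents and the remainder near
   0 cost at most eta / 3 each; the choice of [N1] did the same for the other crescents. *)
pose delta := Num.min e0 (Num.min (eta / (6 * pi * (N1%:R + 1))) (eta / (48 * pi))).
have h6 : 0 < 6 * pi * (N1%:R + 1) :> R by rewrite mulr_gt0 ?mulr_gt0//; lra.
have d1 : 0 < eta / (6 * pi * (N1%:R + 1)) by rewrite divr_gt0.
have d2 : 0 < eta / (48 * pi) by rewrite divr_gt0// mulr_gt0.
exists delta; first by rewrite !lt_min e00 d1 d2.
move=> e /andP[ep]; rewrite !lt_min => /and3P[ee0 ee1 ee2].
(* From index [P1] on the orbit stays in D(0, e), as the remainder estimate requires. *)
have [P1 hP1] := inv_nat_small B ep.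
exists (maxn N1 P1) => P; rewrite geq_max => /andP[NP PP].
have pr m : nc (p m) <= B.
  apply: (le_trans (pB m)); rewrite ler_piMr// invf_le1 ?ltr0n//.
  by rewrite ler1n.
have := @complex_measure_tail _ p e P B ep pr (npe e ltac:(by rewrite ep)).
rewrite -![\sum_(n < P) _](big_mkord xpredT (fun n => (cell e n)%:C * p n)).
rewrite -![\sum_(n < P) _](big_mkord xpredT (fun n => cell e n)).
move=> /(_ _)/le_trans; apply.
  by move=> m Pm; apply: (le_trans (pB m)); apply: hP1; exact: leq_trans Pm.
have hS := sum_cell_le ep NP.
have e2 : 0 < e ^+ 2 by rewrite exprn_gt0.
have h1 : 2 * e * \sum_(0 <= n < P) cell e n <=
    2 * e * (N1%:R * (pi * e ^+ 2) + 3 * pi * e * B * N1.+1%:R^-1).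
  by rewrite ler_pM2l// mulr_gt0.
apply: (le_trans (lerD h1 (lexx _))).
have -> : 2 * e * (N1%:R * (pi * e ^+ 2) + 3 * pi * e * B * N1.+1%:R^-1) + 16 * pi * e ^+ 3
  = (2 * pi * N1%:R * e + 6 * pi * B * N1.+1%:R^-1 + 16 * pi * e) * e ^+ 2 by ring.
rewrite ler_pM2r//.
rewrite ltr_pdivlMr ?mulr_gt0// in ee2.
rewrite ltr_pdivlMr// in ee1.
have pe0 : 0 < pi * e by rewrite mulr_gt0.
have ee1' : 6 * (pi * e * N1%:R) + 6 * (pi * e) < eta by apply: le_lt_trans ee1; lra.
have -> : 2 * pi * N1%:R * e = 2 * (pi * e * N1%:R) by ring.
by move: (6 * pi * B * _) hN (pi * e * N1%:R) ee1' => X hX Y hY; lra.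
Qed.

End Cells.

Lemma omega_le n m : (n <= m)%N -> omega m <= omega n.
Proof.
move=> nm; rewrite /omega lef_pV2 ?posrE ?mulr_gt0 ?ltr0n//.
by apply: ler_pM => //; rewrite ler_nat ltnS.
Qed.

Section Comparison.
Variables (p q : nat -> R[i]) (b B : R).
Hypotheses (hp : harmonic_orbit p b B) (hq : harmonic_orbit q b B).
Hypothesis pq : forall n, nc (p n - q n) <= B * omega n.
Hypothesis dpq : forall n,
  nc ((p n.+1 - p n) - (q n.+1 - q n)) <= B * omega n * n.+1%:R^-1.
Local Notation cellp e n := (crescent e (p n.+1 - p n)).
Local Notation cellq e n := (crescent e (q n.+1 - q n)).

Lemma cell_near e n : 0 < e -> 2 * e <= b * omega n ->
  cellp e n = pi * e ^+ 2 /\ cellq e n = pi * e ^+ 2.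
Proof.
move=> e0 en; have [_ _ _ pD _] := hp; have [_ _ _ qD _] := hq.
have /andP[p1 _] := pD n; have /andP[q1 _] := qD n.
by split; apply: crescent_far => //; lra.
Qed.

(* When the cells differ, [e] is at least of order [omega n], which compensates
   for the factor [e] in the Lipschitz bound of [crescent]. *)
Lemma cell_diff e n : 0 < e ->
  nc ((cellp e n)%:C * p n - (cellq e n)%:C * q n) <=
  (12 * pi * B ^+ 2 / b + pi * B) * e ^+ 2 * omega n.
Proof.
move=> e0; have [b0 B0 pB _ _] := hp; have pi0 := pi_gt0 R.
have w0 := omega_gt0 n.
have -> : (cellp e n)%:C * p n - (cellq e n)%:C * q n =
    (cellp e n - cellq e n)%:C * p n + (cellq e n)%:C * (p n - q n).
  move: (cellp e n) (cellq e n) => x y.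
  by rewrite rmorphB mulrBl mulrBr addrA subrK.
apply: (le_trans (le_normcD _ _)); rewrite mulrDl mulrDl; apply: lerD; last first.
  rewrite ncM nc_real ger0_norm ?crescent_ge0//.
  apply: (@le_trans _ _ (pi * e ^+ 2 * (B * omega n))).
    by apply: ler_pM; rewrite ?crescent_ge0 ?nc_ge0 ?crescent_le.
  lra.
have pos : 0 <= 12 * pi * B ^+ 2 / b * e ^+ 2 * omega n.
  by rewrite !mulr_ge0 ?exprn_ge0 ?invr_ge0// ltW.
have [le|lt] := lerP (2 * e) (b * omega n).
  by have [-> ->] := cell_near e0 le; rewrite subrr mul0r nc0.
rewrite ncM nc_real.
have h1 := crescent_lip (p n.+1 - p n) (q n.+1 - q n) e0.
have h2 : 3 * pi * e * nc (p n.+1 - p n - (q n.+1 - q n)) <=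
    3 * pi * e * (B * omega n * n.+1%:R^-1).
  by rewrite ler_wpM2l ?dpq// !mulr_ge0// ltW.
have h3 : `|cellp e n - cellq e n| * nc (p n) <=
    (3 * pi * e * (B * omega n * n.+1%:R^-1)) * (B * n.+1%:R^-1).
  by apply: ler_pM => //; [exact: nc_ge0|exact: le_trans h1 h2].
apply: (le_trans h3).
have -> : 3 * pi * e * (B * omega n * n.+1%:R^-1) * (B * n.+1%:R^-1) =
  3 * pi * e * B ^+ 2 * omega n * n.+1%:R^-1 ^+ 2 by ring.
(* From 1/(n+1)^2 <= 2 [omega n] and b [omega n] < 2 e; hence the constant 12 = 3 * 4. *)
have h4 : n.+1%:R^-1 ^+ 2 <= 4 * e / b.
  rewrite ler_pdivlMr// mulrC.
  have := ler_wpM2l (ltW b0) (sqr_inv_le_omega n).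
  move: (n.+1%:R^-1 ^+ 2) => x; lra.
apply: (@le_trans _ _ (3 * pi * e * B ^+ 2 * omega n * (4 * e / b))).
  by rewrite ler_wpM2l// !mulr_ge0 ?exprn_ge0// ltW.
lra.
Qed.

(** The order of quantifiers matters. N is chosen first, to make the sum of [cell_diff] beyond N at
    most (eta / 3) e^2 for all e; then delta <= b [omega N] / 2 makes the first N cells full discs
    in both orbits. *)
Lemma complex_measure_compare (eta : R) : 0 < eta ->
  exists N1, forall N, (N1 <= N)%N -> exists2 delta, 0 < delta &
  forall e, 0 < e < delta ->
  nc (complex_measure (tail_nbhd p e 0) - complex_measure (tail_nbhd q e 0) -
      (e ^+ 2)%:C * (pi%:C * \sum_(0 <= n < N) (p n - q n))) <= eta * e ^+ 2.
Proof.
move=> eta0; have [b0 B0 _ _ _] := hp.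
pose C : R := 12 * pi * B ^+ 2 / b + pi * B.
have [N1 hN1] := @inv_nat_small C (eta / 3) ltac:(lra).
exists N1 => N NN1.
have [d1 d10 hd1] := complex_measure_cells hp (eta := eta / 3) ltac:(lra).
have [d2 d20 hd2] := complex_measure_cells hq (eta := eta / 3) ltac:(lra).
have bw : 0 < b * omega N / 2 by rewrite divr_gt0// mulr_gt0// omega_gt0.
exists (Num.min (b * omega N / 2) (Num.min d1 d2)); first by rewrite !lt_min bw d10 d20.
move=> e /andP[e0]; rewrite !lt_min => /and3P[ew e1 e2].
have near n : (n < N)%N -> 2 * e <= b * omega n.
  move=> nN; have : b * omega N <= b * omega n by rewrite ler_pM2l// omega_le// ltnW.
  by move: (b * omega N) ew (b * omega n) => x xe y xy; lra.
have eta3 x : eta / 3 * x + (eta / 3 * x + eta / 3 * x) = eta * x by field.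
have [P1 hP1] := hd1 e ltac:(by rewrite e0 e1).
have [P2 hP2] := hd2 e ltac:(by rewrite e0 e2).
pose P := maxn N (maxn P1 P2).
have NP : (N <= P)%N by rewrite leq_max leqnn.
have {hP1} hP1 := hP1 P ltac:(by rewrite !leq_max leqnn orbT).
have {hP2} hP2 := hP2 P ltac:(by rewrite !leq_max leqnn !orbT).
set Mp := complex_measure _ in hP1 *; set Mq := complex_measure _ in hP2 *.
set Sp := \sum_(_ <= n < _) _ in hP1; set Sq := \sum_(_ <= n < _) _ in hP2.
have hS : nc (Sp - Sq - (e ^+ 2)%:C * (pi%:C * \sum_(0 <= n < N) (p n - q n))) <=
    eta / 3 * e ^+ 2.
  rewrite /Sp /Sq -sumrB (@big_cat_nat _ _ _ N)//=.
  have -> : \sum_(0 <= n < N) ((cellp e n)%:C * p n - (cellq e n)%:C * q n) =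
      (e ^+ 2)%:C * (pi%:C * \sum_(0 <= n < N) (p n - q n)).
    rewrite !mulr_sumr; apply: eq_big_nat => n /andP[_ nN].
    have [-> ->] := cell_near e0 (near n nN).
    by rewrite rmorphM /=; ring.
  rewrite addrAC subrr add0r; apply: (le_trans (nc_sum _ _ _)).
  apply: (@le_trans _ _ (\sum_(N <= n < P) C * e ^+ 2 * omega n)).
    by apply: ler_sum => n _; exact: cell_diff.
  rewrite -mulr_sumr.
  have C0 : 0 <= C * e ^+ 2.
    by rewrite mulr_ge0 ?exprn_ge0 ?(ltW e0)// addr_ge0 ?mulr_ge0 ?exprn_ge0 ?invr_ge0 ?pi_ge0 ?(ltW b0).
  apply: (le_trans (ler_wpM2l C0 (sum_omega N P))).
  by rewrite mulrAC ler_wpM2r ?exprn_ge0 ?(ltW e0)// hN1.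
have -> : Mp - Mq - (e ^+ 2)%:C * (pi%:C * \sum_(0 <= n < N) (p n - q n)) =
  (Mp - Sp) + (- (Mq - Sq) + (Sp - Sq - (e ^+ 2)%:C * (pi%:C * \sum_(0 <= n < N) (p n - q n)))).
  by ring.
apply: (le_trans (le_normcD _ _)).
have := le_normcD (- (Mq - Sq)) (Sp - Sq - (e ^+ 2)%:C * (pi%:C * \sum_(0 <= n < N) (p n - q n))).
rewrite normcN -eta3 => h; apply: lerD hP1 _.
exact: le_trans h (lerD hP2 hS).
Qed.

End Comparison.

Lemma ReZ (a : R) (x : R[i]) : complex.Re (a%:C * x) = a * complex.Re x.
Proof. by case: x => x y /=; rewrite mul0r subr0. Qed.

Lemma Re_sum (I : Type) (s : seq I) (F : I -> R[i]) :
  complex.Re (\sum_(i <- s) F i) = \sum_(i <- s) complex.Re (F i).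
Proof. by elim: s => [|a s IH]; rewrite ?big_nil// !big_cons cReD IH. Qed.

(** For an orbit on one side of the imaginary axis the real parts of the cell contributions cannot
    cancel, so the first N full discs bound the measure from below. This serves to exclude 0 from
    the petal; the - 1 is the error of [complex_measure_cells]. *)
Lemma complex_measure_lower p (b B s : R) : harmonic_orbit p b B ->
  `|s| = 1 -> (forall n, 0 <= s * complex.Re (p n)) ->
  forall N, exists2 delta, 0 < delta & forall e, 0 < e < delta ->
  (pi * (\sum_(0 <= n < N) s * complex.Re (p n)) - 1) * e ^+ 2 <=
  nc (complex_measure (tail_nbhd p e 0)).
Proof.
move=> hp s1 sp N; have [b0 B0 _ pD _] := hp.
have [d1 d10 hd1] := complex_measure_cells hp (eta := 1) ltac:(lra).
have bw : 0 < b * omega N / 2 by rewrite divr_gt0// mulr_gt0// omega_gt0.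
exists (Num.min (b * omega N / 2) d1); first by rewrite !lt_min bw d10.
move=> e /andP[e0]; rewrite !lt_min => /andP[ew e1].
have near n : (n < N)%N -> 2 * e <= b * omega n.
  move=> nN; have : b * omega N <= b * omega n by rewrite ler_pM2l// omega_le// ltnW.
  by move: (b * omega N) ew (b * omega n) => x xe y xy; lra.
have [P1 hP1] := hd1 e ltac:(by rewrite e0 e1).
pose P := maxn N P1.
have NP : (N <= P)%N by rewrite leq_max leqnn.
have {hP1} := hP1 P ltac:(by rewrite leq_max leqnn orbT).
set M := complex_measure _; set S := \sum_(_ <= n < _) _.
rewrite mul1r => hM.
suff : pi * (\sum_(0 <= n < N) s * complex.Re (p n)) * e ^+ 2 <= nc S.
  by have := nc_sub_ge S M; rewrite ncB; lra.
apply: (le_trans _ (Re_le_nc S)); rewrite -[`|_|]mul1r -s1 -normrM.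
apply: (le_trans _ (ler_norm _)).
rewrite /S Re_sum [X in _ <= X]mulr_sumr [X in _ <= X](@big_cat_nat _ _ _ N)//=.
apply: (@le_trans _ _ (\sum_(0 <= n < N)
    s * complex.Re ((crescent e (p n.+1 - p n))%:C * p n))); last first.
  rewrite lerDl sumr_ge0// => n _; rewrite ReZ mulrCA mulr_ge0// crescent_ge0//.
rewrite mulrC !mulr_sumr big_nat [X in _ <= X]big_nat; apply: ler_sum => n /andP[_ nN].
rewrite crescent_far//.
  by rewrite ReZ; lra.
by have /andP[p1 _] := pD n; exact: le_trans (near n nN) p1.
Qed.

End OrbitMeasure.

(** * Absolutely convergent power series *)

Section Limits.
Variable R : realType.
Implicit Types (u v : nat -> R[i]) (l : R[i]) (e : R).

(** Convergence with real tolerances instead of positive elements of [R[i]]. *)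
Definition clim u l := forall e, 0 < e -> exists N, forall n, (N <= n)%N -> nc (u n - l) <= e.

Lemma gt0_real (x : R[i]) : 0 < x -> exists2 r : R, 0 < r & x = r%:C.
Proof. by case: x => a b; rewrite ltcE/= => /andP[/eqP -> a0]; exists a. Qed.

Lemma cvg_clim u l : u n @[n --> \oo] --> l <-> clim u l.
Proof.
split.
  move=> /cvgrPdist_le ul e e0.
  have [|N _ hN] := ul e%:C; first by rewrite ltcR.
  by exists N => n Nn; rewrite ncB -norm_lec; exact: hN.
move=> ul; apply/cvgrPdist_le => _ /gt0_real[e e0 ->].
have [N hN] := ul _ e0; exists N => // n /= Nn.
by rewrite norm_lec ncB; exact: hN.
Qed.

Lemma near_nc (z : R[i]) (P : R[i] -> Prop) :
  (\forall w \near z, P w) <-> exists2 r : R, 0 < r & forall w, nc (w - z) < r -> P w.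
Proof.
split.
  move=> /nbhs_normP[_ /gt0_real[e e0 ->] he].
  exists e => // w wz; apply: he => /=.
  by rewrite norm_ltc ncB.
move=> [r r0 h]; apply/nbhs_normP; exists r%:C => /=; first by rewrite ltcR.
by move=> w /=; rewrite norm_ltc ncB; exact: h.
Qed.

Lemma clim_unique u l l' : clim u l -> clim u l' -> l = l'.
Proof.
move=> ul ul'; apply/eqP; rewrite -subr_eq0 -nc_eq0 eq_le nc_ge0 andbT.
apply/ler_addgt0Pr => e e0; rewrite add0r.
have [N hN] := ul (e / 2) ltac:(lra); have [M hM] := ul' (e / 2) ltac:(lra).
have := hN (maxn N M) (leq_maxl _ _); have := hM (maxn N M) (leq_maxr _ _).
by have := nc_triangle (u (maxn N M)) l l'; rewrite [nc (l - u _)]ncB; lra.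
Qed.

Lemma clim_cst l : clim (fun=> l) l.
Proof. by move=> e e0; exists 0%N => n _; rewrite subrr nc0 ltW. Qed.

Lemma climD u v l l' : clim u l -> clim v l' -> clim (fun n => u n + v n) (l + l').
Proof.
move=> ul vl e e0.
have [N hN] := ul (e / 2) ltac:(lra); have [M hM] := vl (e / 2) ltac:(lra).
exists (maxn N M) => n; rewrite geq_max => /andP[/hN h1 /hM h2].
have -> : u n + v n - (l + l') = (u n - l) + (v n - l') by ring.
by have := le_normcD (u n - l) (v n - l'); lra.
Qed.

Lemma climZ u l c : clim u l -> clim (fun n => c * u n) (c * l).
Proof.
move=> ul e e0; have c0 := nc_ge0 c.
have [|N hN] := ul (e / (nc c + 1)); first by rewrite divr_gt0//; lra.
exists N => n /hN h; rewrite -mulrBr ncM.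
have : nc c * nc (u n - l) <= nc c * (e / (nc c + 1)) by rewrite ler_wpM2l.
have : (nc c + 1) * (e / (nc c + 1)) = e by rewrite mulrC divfK// gt_eqF//; lra.
have : 0 < e / (nc c + 1) by rewrite divr_gt0//; lra.
by move: (e / _) => x; nra.
Qed.

Lemma clim_eq u v l : u =1 v -> clim u l -> clim v l.
Proof. by move=> /funext ->. Qed.

Lemma clim_shift u l k : clim (fun n => u (k + n)%N) l -> clim u l.
Proof.
move=> ul e e0; have [N hN] := ul e e0; exists (k + N)%N => n kn.
have -> : n = (k + (n - k))%N by rewrite subnKC// (leq_trans _ kn)// leq_addr.
by apply: hN; rewrite leq_subRL// (leq_trans _ kn)// leq_addr.
Qed.

Lemma clim_le u l (M : R) : clim u l -> (forall n, nc (u n) <= M) -> nc l <= M.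
Proof.
move=> ul uM; apply/ler_addgt0Pr => e e0; have [N /(_ _ (leqnn N)) hN] := ul e e0.
by have := nc_sub_ge l (u N); rewrite ncB; have := uM N; lra.
Qed.

Lemma bounded_tails (m : nat -> R) (M : R) : (forall n, 0 <= m n) ->
  (forall N, \sum_(0 <= n < N) m n <= M) ->
  forall e, 0 < e -> exists N, forall P, \sum_(N <= n < P) m n <= e.
Proof.
move=> m0 mM e e0; pose A := range (fun N => \sum_(0 <= n < N) m n).
have hA : has_sup A.
  by split; [exists 0, 0%N => //; rewrite big_geq|exists M => _ [N _ <-]].
have [_ [N _ <-] hN] := sup_adherent e0 hA.
exists N => P; have [NP|/ltnW PN] := leqP N P; last by rewrite big_geq// ltW.
have : \sum_(0 <= n < P) m n <= sup A by apply: ub_le_sup; [exact: hA.2|exists P].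
by rewrite (@big_cat_nat _ _ _ N)//=; lra.
Qed.

Lemma abs_series_clim u (M : R) : (forall N, \sum_(0 <= n < N) nc (u n) <= M) ->
  exists l, clim (fun N => \sum_(0 <= n < N) u n) l.
Proof.
move=> uM.
have real_part (v : nat -> R) : (forall n, `|v n| <= nc (u n)) ->
    exists l : R, forall e, 0 < e -> exists N, forall n, (N <= n)%N ->
      `|\sum_(0 <= k < n) v k - l| <= e.
  move=> vu; have : cvgn (series v).
    apply: normed_cvg; apply: nondecreasing_is_cvgn.
      move=> i j ij; rewrite /series/= [X in _ <= X](@big_cat_nat _ _ _ i)//=.
      by rewrite lerDl sumr_ge0.
    exists M => _ [N _ <-]; apply: le_trans (uM N).
    by apply: ler_sum => n _; exact: vu.
  move=> /cvg_ex[l hl]; exists l => e e0.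
  have /cvgrPdist_le /(_ e e0) [N _ hN] := hl.
  by exists N => n Nn; rewrite distrC; exact: hN.
have [l1 h1] := real_part (fun n => complex.Re (u n)) (fun n => Re_le_nc (u n)).
have [l2 h2] := real_part (fun n => complex.Im (u n)) (fun n => Im_le_nc (u n)).
exists (l1 +i* l2) => e e0.
have [N1 hN1] := h1 (e / 2) ltac:(lra); have [N2 hN2] := h2 (e / 2) ltac:(lra).
exists (maxn N1 N2) => n; rewrite geq_max => /andP[/hN1 g1 /hN2 g2].
have RS : forall N, \sum_(0 <= k < N) u k =
    (\sum_(0 <= k < N) complex.Re (u k)) +i* (\sum_(0 <= k < N) complex.Im (u k)).
  elim=> [|N IH]; first by rewrite !big_geq.
  by rewrite !big_nat_recr//= IH; case: (u N) => a b; simpc.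
apply: (le_trans (nc_le_ReIm _)); rewrite RS /=.
by lra.
Qed.

End Limits.

(** * The Wiener algebra of a disc *)

Section Wiener.
Variable R : realType.
Implicit Types (phi psi : R[i] -> R[i]) (r M : R) (a : nat -> R[i]).

(* [phi] has a power series at [z0] whose norm [\sum_n |a n| r^n] in the Wiener
   algebra of the disc of radius [r] is at most [M]. *)
Definition wiener (z0 : R[i]) r phi M := exists a,
  (forall N, \sum_(0 <= n < N) nc (a n) * r ^+ n <= M) /\
  forall u, nc u <= r -> clim (fun N => \sum_(0 <= n < N) a n * u ^+ n) (phi (z0 + u)).

Lemma wiener_ge0 z0 r phi M : wiener z0 r phi M -> 0 <= M.
Proof. by move=> [a [/(_ 0%N)]]; rewrite big_geq. Qed.

Lemma wiener_le z0 r phi M M' : M <= M' -> wiener z0 r phi M -> wiener z0 r phi M'.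
Proof. by move=> MM [a [h1 h2]]; exists a; split => // N; apply: le_trans MM. Qed.

Lemma wiener_eq z0 r phi psi M : (forall u, nc u <= r -> phi (z0 + u) = psi (z0 + u)) ->
  wiener z0 r phi M -> wiener z0 r psi M.
Proof. by move=> e [a [h1 h2]]; exists a; split => // u ur; rewrite -e//; exact: h2. Qed.

Lemma wiener_radius z0 r r' phi M : 0 <= r' <= r -> wiener z0 r phi M -> wiener z0 r' phi M.
Proof.
move=> /andP[r0 rr] [a [h1 h2]]; exists a; split => [N|u ur]; last by apply: h2; exact: le_trans rr.
apply: le_trans (h1 N); apply: ler_sum => n _; rewrite ler_wpM2l ?nc_ge0//.
by apply: lerXn2r => //; rewrite nnegrE// (le_trans r0).
Qed.

Lemma wiener_bound z0 r phi M u : wiener z0 r phi M -> nc u <= r -> nc (phi (z0 + u)) <= M.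
Proof.
move=> [a [h1 h2]] ur; apply: clim_le (h2 u ur) _ => n.
apply: (le_trans (nc_sum _ _ _)); apply: le_trans (h1 n); apply: ler_sum => k _.
rewrite ncM ncX ler_wpM2l ?nc_ge0//; apply: lerXn2r; rewrite ?nnegrE ?nc_ge0//.
exact: le_trans (nc_ge0 u) ur.
Qed.

Lemma wiener_bound' z0 r phi M z : wiener z0 r phi M -> nc (z - z0) <= r -> nc (phi z) <= M.
Proof. by move=> h zr; have := wiener_bound h zr; rewrite subrKC. Qed.

Lemma wiener_cst z0 r c : 0 <= r -> wiener z0 r (fun=> c) (nc c).
Proof.
move=> r0; exists (fun n => if n is 0%N then c else 0); split.
  case=> [|N]; first by rewrite big_geq ?nc_ge0.
  rewrite big_nat_recl//= expr0 mulr1 big1 ?addr0//.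
  by move=> n _; rewrite nc0 mul0r.
move=> u _; apply: (@clim_shift _ _ _ 1); apply: clim_eq (clim_cst c) => N.
by rewrite add1n big_nat_recl//= expr0 mulr1 big1 ?addr0// => n _; rewrite mul0r.
Qed.

Lemma wiener_add z0 r phi psi M M' : 0 <= r -> wiener z0 r phi M -> wiener z0 r psi M' ->
  wiener z0 r (fun z => phi z + psi z) (M + M').
Proof.
move=> r0 [a [h1 h2]] [b [g1 g2]]; exists (fun n => a n + b n); split => [N|u ur].
  apply: le_trans (lerD (h1 N) (g1 N)); rewrite -big_split/=; apply: ler_sum => n _.
  by rewrite -mulrDl ler_wpM2r ?exprn_ge0// le_normcD.
apply: clim_eq (climD (h2 u ur) (g2 u ur)) => N.
by rewrite -big_split/=; apply: eq_bigr => n _; rewrite mulrDl.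
Qed.

Lemma wiener_scale z0 r phi M c : wiener z0 r phi M ->
  wiener z0 r (fun z => c * phi z) (nc c * M).
Proof.
move=> [a [h1 h2]]; exists (fun n => c * a n); split => [N|u ur].
  have -> : \sum_(0 <= n < N) nc (c * a n) * r ^+ n = nc c * \sum_(0 <= n < N) nc (a n) * r ^+ n.
    by rewrite mulr_sumr; apply: eq_bigr => n _; rewrite ncM mulrA.
  by rewrite ler_wpM2l ?nc_ge0.
apply: clim_eq (climZ c (h2 u ur)) => N.
by rewrite mulr_sumr; apply: eq_bigr => n _; rewrite mulrA.
Qed.

Lemma wiener_shift z0 r phi M : 0 <= r -> wiener z0 r phi M ->
  wiener z0 r (fun z => (z - z0) * phi z) (r * M).
Proof.
move=> r0 h; have M0 := wiener_ge0 h; case: h => a [h1 h2].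
exists (fun n => if n is n'.+1 then a n' else 0); split.
  case=> [|N]; first by rewrite big_geq ?mulr_ge0.
  rewrite big_nat_recl//= nc0 mul0r add0r.
  apply: le_trans (ler_wpM2l r0 (h1 N)); rewrite mulr_sumr; apply: ler_sum => n _.
  by rewrite exprS mulrCA.
move=> u ur; apply: (@clim_shift _ _ _ 1).
have -> : z0 + u - z0 = u by rewrite addrAC subrr add0r.
apply: clim_eq (climZ u (h2 u ur)) => N.
rewrite add1n big_nat_recl//= mul0r add0r mulr_sumr; apply: eq_bigr => n _.
by rewrite exprS mulrCA.
Qed.

Lemma wiener_shiftn z0 r phi M k : 0 <= r -> wiener z0 r phi M ->
  wiener z0 r (fun z => (z - z0) ^+ k * phi z) (r ^+ k * M).
Proof.
move=> r0 h; elim: k => [|k IH].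
  by rewrite expr0 mul1r; apply: wiener_eq h => u _; rewrite expr0 mul1r.
rewrite exprS -mulrA; apply: wiener_eq (wiener_shift r0 IH) => u _.
by rewrite exprS mulrA.
Qed.

(** Completeness of the algebra: the series is summed coefficient by coefficient, and the summable
    norms [m k] justify the interchange. Products and compositions are obtained from it. *)
Lemma wiener_sum z0 r (phi : nat -> R[i] -> R[i]) psi (m : nat -> R) M : 0 < r ->
  (forall k, wiener z0 r (phi k) (m k)) ->
  (forall K, \sum_(0 <= k < K) m k <= M) ->
  (forall u, nc u <= r -> clim (fun K => \sum_(0 <= k < K) phi k (z0 + u)) (psi (z0 + u))) ->
  wiener z0 r psi M.
Proof.
move=> r0 h mM hpsi; have m0 k := wiener_ge0 (h k).
have [a ha] := choice h.
have am k n : nc (a k n) * r ^+ n <= m k.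
  apply: le_trans ((ha k).1 n.+1); rewrite big_nat_recr//= lerDr sumr_ge0// => i _.
  by rewrite mulr_ge0 ?nc_ge0 ?exprn_ge0// ltW.
have hA n : exists A, clim (fun K => \sum_(0 <= k < K) a k n) A.
  apply: (@abs_series_clim _ _ (M / r ^+ n)) => K.
  rewrite ler_pdivlMr ?exprn_gt0// mulr_suml; apply: le_trans (mM K).
  by apply: ler_sum => k _; exact: am.
have {hA}[A hA] := choice hA.
have partA K N : \sum_(0 <= n < N) nc (\sum_(0 <= k < K) a k n) * r ^+ n <= M.
  apply: (@le_trans _ _ (\sum_(0 <= n < N) \sum_(0 <= k < K) nc (a k n) * r ^+ n)).
    apply: ler_sum => n _; rewrite -mulr_suml ler_wpM2r ?exprn_ge0 ?(ltW r0)//.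
    exact: nc_sum.
  rewrite exchange_big /=; apply: le_trans (mM K); apply: ler_sum => k _.
  exact: (ha k).1.
have close e N : 0 < e -> exists K1, forall K, (K1 <= K)%N ->
    \sum_(0 <= n < N) nc (A n - \sum_(0 <= k < K) a k n) * r ^+ n <= e.
  elim: N e => [|N IH] e e0; first by exists 0%N => K _; rewrite big_geq// ltW.
  have rN : 0 < r ^+ N by rewrite exprn_gt0.
  have [K1 hK1] := IH (e / 2) ltac:(lra).
  have [|K2 hK2] := hA N (e / 2 / r ^+ N); first by rewrite !divr_gt0.
  exists (maxn K1 K2) => K; rewrite geq_max => /andP[/hK1 g1 /hK2].
  by rewrite ler_pdivlMr// ncB big_nat_recr//=; lra.
(* [close] depends on N. Uniformity in N comes from passing through a later index K' chosen for N:
   between K and K' the tail of [m] controls the difference. *)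
have tailA e : 0 < e -> exists K0, forall K N, (K0 <= K)%N ->
    \sum_(0 <= n < N) nc (A n - \sum_(0 <= k < K) a k n) * r ^+ n <= e.
  move=> e0; have [K0 hK0] := bounded_tails m0 mM (e := e / 2) ltac:(lra).
  exists K0 => K N KK; have [K1 hK1] := close (e / 2) N ltac:(lra).
  pose K' := maxn K K1.
  have KK' : (K <= K')%N by rewrite leq_maxl.
  have {hK1} hK1 := hK1 K' (leq_maxr _ _).
  have h2 : \sum_(0 <= n < N) nc (\sum_(K <= k < K') a k n) * r ^+ n <= e / 2.
    apply: (@le_trans _ _ (\sum_(0 <= n < N) \sum_(K <= k < K') nc (a k n) * r ^+ n)).
      apply: ler_sum => n _; rewrite -mulr_suml ler_wpM2r ?exprn_ge0 ?(ltW r0)//.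
      exact: nc_sum.
    rewrite exchange_big /=; apply: le_trans (hK0 K').
    rewrite [X in _ <= X](@big_cat_nat _ _ _ K)//=.
    apply: (@le_trans _ _ (\sum_(K <= k < K') m k)); last by rewrite lerDr sumr_ge0.
    by apply: ler_sum => k _; exact: (ha k).1.
  have -> : e = e / 2 + e / 2 by field.
  apply: le_trans (lerD hK1 h2); rewrite -big_split/=; apply: ler_sum => n _.
  rewrite -mulrDl ler_wpM2r ?exprn_ge0 ?(ltW r0)//.
  apply: le_trans (le_normcD _ _); rewrite [X in nc (_ - X + _)](@big_cat_nat _ _ _ K)//=.
  by rewrite opprD addrA subrK.
exists A; split => [N|u ur].
  apply/ler_addgt0Pr => e e0; have [K0 hK0] := tailA e e0.
  have := hK0 K0 N (leqnn _); have := partA K0 N => g1 g2.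
  apply: le_trans (lerD g1 g2); rewrite -big_split/=; apply: ler_sum => n _.
  rewrite -mulrDl ler_wpM2r ?exprn_ge0 ?(ltW r0)//.
  by have := nc_sub_ge (A n) (\sum_(0 <= k < K0) a k n); lra.
move=> e e0; have [K0 hK0] := tailA (e / 3) ltac:(lra).
have [K1 hK1] := hpsi u ur (e / 3) ltac:(lra).
pose K := maxn K0 K1.
have {}hK1 := hK1 K (leq_maxr _ _).
have : clim (fun N => \sum_(0 <= k < K) \sum_(0 <= n < N) a k n * u ^+ n)
    (\sum_(0 <= k < K) phi k (z0 + u)).
  elim: (K) => [|k IH]; first by rewrite big_geq//; apply: clim_eq (clim_cst 0) => N; rewrite big_geq.
  rewrite big_nat_recr//=; apply: clim_eq (climD IH ((ha k).2 u ur)) => N.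
  by rewrite big_nat_recr.
move=> /(_ (e / 3) ltac:(lra))[N0 hN0]; exists N0 => N /hN0 {}hN0.
have {hK0} : nc (\sum_(0 <= n < N) (A n - \sum_(0 <= k < K) a k n) * u ^+ n) <= e / 3.
  apply: le_trans (hK0 K N (leq_maxl _ _)); apply: (le_trans (nc_sum _ _ _)).
  apply: ler_sum => n _; rewrite ncM ncX ler_wpM2l ?nc_ge0//.
  by apply: lerXn2r; rewrite ?nnegrE ?nc_ge0 ?(ltW r0).
have -> : \sum_(0 <= n < N) (A n - \sum_(0 <= k < K) a k n) * u ^+ n =
    \sum_(0 <= n < N) A n * u ^+ n - \sum_(0 <= k < K) \sum_(0 <= n < N) a k n * u ^+ n.
  rewrite exchange_big /= -sumrB; apply: eq_bigr => n _.
  by rewrite mulrBl mulr_suml.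
move: hK1 hN0; set x := \sum_(_ <= _ < _) _; set y := \sum_(_ <= _ < _) _; set z := \sum_(_ <= _ < _) _.
by have := nc_triangle x z (psi (z0 + u)); have := nc_triangle y x (psi (z0 + u)); lra.
Qed.

(** The product is the sum of the functions a_k (z - z0)^k psi(z), where multiplying by z - z0
    merely shifts coefficients; no Cauchy product is formed. *)
Lemma wiener_mul z0 r phi psi M M' : 0 < r -> wiener z0 r phi M -> wiener z0 r psi M' ->
  wiener z0 r (fun z => phi z * psi z) (M * M').
Proof.
move=> r0 [a [h1 h2]] hpsi; have M'0 := wiener_ge0 hpsi.
apply: (@wiener_sum z0 r (fun k z => a k * ((z - z0) ^+ k * psi z)) _
  (fun k => nc (a k) * (r ^+ k * M'))) => //.
- by move=> k; apply/wiener_scale/wiener_shiftn => //; exact: ltW.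
- move=> K; apply: le_trans (ler_wpM2r M'0 (h1 K)); rewrite mulr_suml.
  by apply: ler_sum => k _; rewrite mulrA.
- move=> u ur; have := climZ (psi (z0 + u)) (h2 u ur).
  rewrite mulrC; apply: clim_eq => N; rewrite mulr_sumr; apply: eq_bigr => k _.
  by rewrite [z0 + u - z0]addrAC subrr add0r; ring.
Qed.

Lemma wiener_exp z0 r phi M k : 0 < r -> wiener z0 r phi M ->
  wiener z0 r (fun z => phi z ^+ k) (M ^+ k).
Proof.
move=> r0 h; elim: k => [|k IH].
  by rewrite expr0 -[1]nc1; apply: wiener_cst; exact: ltW.
by rewrite exprS; apply: wiener_eq (wiener_mul r0 h IH) => u _; rewrite exprS.
Qed.

(** The powers of psi - c have norm at most m^k <= s^k, so the expansion of K at c can be summed in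
    the algebra. *)
Lemma wiener_comp c s K M z0 r psi m : 0 < r -> wiener c s K M ->
  wiener z0 r (fun z => psi z - c) m -> m <= s -> wiener z0 r (fun z => K (psi z)) M.
Proof.
move=> r0 [a [h1 h2]] hpsi ms; have m0 := wiener_ge0 hpsi.
apply: (@wiener_sum z0 r (fun k z => a k * (psi z - c) ^+ k) _ (fun k => nc (a k) * m ^+ k)) => //.
- by move=> k; apply/wiener_scale/wiener_exp.
- move=> N; apply: le_trans (h1 N); apply: ler_sum => k _; rewrite ler_wpM2l ?nc_ge0//.
  by apply: lerXn2r => //; rewrite nnegrE// (le_trans m0).
- move=> u ur; have := h2 (psi (z0 + u) - c); rewrite subrKC; apply.
  exact: le_trans (wiener_bound hpsi ur) ms.
Qed.

Lemma nc_expr_small (x e : R) : 0 <= x < 1 -> 0 < e -> exists N, forall n, (N <= n)%N -> x ^+ n <= e.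
Proof.
move=> /andP[x0 x1] e0; have /cvgrPdist_le /(_ e e0)[N _ hN] : x ^+ n @[n --> \oo] --> 0.
  by apply: cvg_expr; rewrite ger0_norm.
exists N => n Nn; have := hN n Nn; rewrite sub0r normrN; exact: le_trans (ler_norm _).
Qed.

Lemma geometric_sum (T : comPzRingType) (x : T) N :
  (1 - x) * \sum_(0 <= i < N) x ^+ i = 1 - x ^+ N.
Proof.
elim: N => [|N IH]; first by rewrite big_geq// mulr0 expr0 subrr.
by rewrite big_nat_recr//= mulrDr IH exprS; ring.
Qed.

(** Geometric series at c; the bound is the sum of s^n / |c|^(n+1). *)
Lemma wiener_inv c s : 0 <= s < nc c -> wiener c s (fun z => z^-1) (nc c - s)^-1.
Proof.
move=> /andP[s0 sc]; have c0 : c != 0 by rewrite -nc_gt0 (le_lt_trans s0).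
have nc0' : 0 < nc c by rewrite nc_gt0.
exists (fun n => c^-1 * (- c^-1) ^+ n); split => [N|u us].
  pose x := s / nc c; have x0 : 0 <= x by rewrite divr_ge0// ltW.
  have x1 : x < 1 by rewrite ltr_pdivrMr ?mul1r.
  have E n : nc (c^-1 * (- c^-1) ^+ n) * s ^+ n = (nc c)^-1 * x ^+ n.
    by rewrite ncM ncX normcN ncV exprMn; ring.
  under eq_bigr do rewrite E; rewrite -mulr_sumr.
  have -> : (nc c - s)^-1 = (nc c)^-1 * (1 - x)^-1.
    by rewrite -invfM /x; congr (_^-1); field; rewrite gt_eqF.
  rewrite ler_wpM2l ?invr_ge0 ?(ltW nc0')//.
  have x1' : 0 < 1 - x by rewrite subr_gt0.
  rewrite -(ler_pM2l x1') divff ?gt_eqF// geometric_sum.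
  by rewrite gerBl exprn_ge0.
pose y := - (u / c).
have cu : c + u != 0.
  by rewrite -nc_gt0; have := nc_add_ge c u; lra.
have y1 : 0 <= nc y < 1.
  by rewrite nc_ge0/= normcN ncM ncV ltr_pdivrMr// mul1r; lra.
have E N : \sum_(0 <= n < N) c^-1 * (- c^-1) ^+ n * u ^+ n = (1 - y ^+ N) / (c + u).
  have -> : \sum_(0 <= n < N) c^-1 * (- c^-1) ^+ n * u ^+ n = c^-1 * \sum_(0 <= n < N) y ^+ n.
    rewrite mulr_sumr; apply: eq_bigr => n _; rewrite -mulrA -exprMn.
    by congr (_ * _ ^+ _); rewrite /y mulNr mulrC.
  rewrite -geometric_sum; move: (\sum_(0 <= i < N) _) => S.
  by rewrite /y; field; rewrite cu c0.
move=> e e0; have e0' : 0 < e * nc (c + u) by rewrite mulr_gt0// nc_gt0.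
have [N hN] := nc_expr_small y1 e0'.
exists N => n Nn; rewrite E.
have -> : (1 - y ^+ n) / (c + u) - (c + u)^-1 = - (y ^+ n / (c + u)) by rewrite mulrBl; ring.
by rewrite normcN ncM ncV ncX ler_pdivrMr ?nc_gt0//; exact: hN.
Qed.

Lemma wiener_analytic z0 r phi M : 0 < r -> wiener z0 r phi M -> analytic_at phi z0.
Proof.
move=> r0 [a [h1 h2]]; exists a; apply/near_nc; exists r => // w wr.
apply/cvg_clim; have := h2 (w - z0) (ltW wr); rewrite subrKC; exact.
Qed.

(** Abel's lemma: convergence at one point at distance s bounds the terms a_n s^n, and halving the
    radius gives a convergent geometric majorant. *)
Lemma analytic_wiener z0 phi : analytic_at phi z0 ->
  exists r M, 0 < r /\ wiener z0 r phi M.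
Proof.
move=> [a /near_nc[r r0 h]].
have hr w : nc (w - z0) < r -> clim (fun N => \sum_(0 <= n < N) a n * (w - z0) ^+ n) (phi w).
  by move=> wr; apply/cvg_clim; exact: h.
pose s := r / 2; have s0 : 0 < s by rewrite divr_gt0.
have sn : nc (s%:C : R[i]) = s by rewrite nc_real ger0_norm// ltW.
have [|N hN] := hr (z0 + s%:C) _ 1 ltac:(lra).
  by rewrite [z0 + _ - z0]addrAC subrr add0r sn /s; lra.
rewrite [z0 + _ - z0]addrAC subrr add0r in hN.
(* Terms before N are bounded by the sum; a later one is the difference of two partial sums within 1
   of the limit, hence at most 2. *)
pose B := \sum_(0 <= n < N) nc (a n) * s ^+ n + 2.
have B0 : 0 <= B.
  by rewrite addr_ge0// sumr_ge0// => n _; rewrite mulr_ge0 ?nc_ge0 ?exprn_ge0// ltW.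
have aB n : nc (a n) * s ^+ n <= B.
  have t0 k : 0 <= nc (a k) * s ^+ k by rewrite mulr_ge0 ?nc_ge0 ?exprn_ge0// ltW.
  have T0 i j : 0 <= \sum_(i <= k < j) nc (a k) * s ^+ k by rewrite sumr_ge0.
  have [Nn|nN] := leqP N n; last first.
    rewrite /B (@big_cat_nat _ _ _ n.+1)//= big_nat_recr//=.
    by have := T0 0%N n; have := T0 n.+1 N; lra.
  have S0 := T0 0%N N.
  have := hN n.+1 (leqW Nn); rewrite big_nat_recr//=; have := hN n Nn.
  set S := \sum_(_ <= _ < _) _ => g1 g2.
  have -> : nc (a n) * s ^+ n = nc (a n * s%:C ^+ n) by rewrite ncM ncX sn.
  have -> : a n * s%:C ^+ n = (S + a n * s%:C ^+ n - phi (z0 + s%:C)) - (S - phi (z0 + s%:C)) by ring.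
  by apply: (le_trans (nc_subr _ _)); rewrite /B; lra.
exists (s / 2), (B * 2); split; first by rewrite divr_gt0.
exists a; split => [K|u us].
  apply: (@le_trans _ _ (B * \sum_(0 <= n < K) 2^-1 ^+ n)).
    rewrite mulr_sumr; apply: ler_sum => n _.
    by rewrite exprMn mulrA ler_wpM2r ?exprn_ge0// invr_ge0.
  rewrite ler_wpM2l//.
  have p0 : 0 <= (2^-1 : R) ^+ K by rewrite exprn_ge0 ?invr_ge0.
  by have := @geometric_sum R 2^-1 K; lra.
have := hr (z0 + u); rewrite [z0 + u - z0]addrAC subrr add0r; apply.
by rewrite /s in us; lra.
Qed.

(** [chi] is the difference quotient at z0, completed by the derivative [a 1] at z0; its
    coefficients are those of phi shifted by one. *)
Lemma wiener_factor z0 r phi M : 0 < r -> wiener z0 r phi M -> exists chi,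
  wiener z0 r chi (M / r) /\ forall u, nc u <= r -> phi (z0 + u) = phi z0 + u * chi (z0 + u).
Proof.
move=> r0 [a [h1 h2]].
have a0 : phi z0 = a 0%N.
  have := h2 0; rewrite nc0 addr0 => /(_ (ltW r0)) h; apply: clim_unique h _.
  apply: (@clim_shift _ _ _ 1); apply: clim_eq (clim_cst _) => N.
  by rewrite add1n big_nat_recl//= expr0 mulr1 big1 ?addr0// => n _; rewrite expr0n mulr0.
exists (fun z => if z == z0 then a 1%N else (phi z - phi z0) / (z - z0)); split; last first.
  move=> u ur; have [->|u0] := eqVneq u 0; first by rewrite !addr0 mul0r addr0.
  have -> : (z0 + u == z0) = false by rewrite -subr_eq0 addrAC subrr add0r (negbTE u0).
  by rewrite [z0 + u - z0]addrAC subrr add0r; field.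
exists (fun n => a n.+1); split => [N|u ur].
  rewrite ler_pdivlMr//; apply: le_trans (h1 N.+1).
  rewrite big_nat_recl//= -[X in X <= _]add0r; apply: lerD.
    by rewrite mulr_ge0 ?nc_ge0.
  rewrite mulr_suml; apply: ler_sum => n _; rewrite exprS; lra.
have [->|u0] := eqVneq u 0.
  rewrite addr0 eqxx; apply: (@clim_shift _ _ _ 1); apply: clim_eq (clim_cst _) => N.
  by rewrite add1n big_nat_recl//= expr0 mulr1 big1 ?addr0// => n _; rewrite expr0n mulr0.
have -> : (z0 + u == z0) = false by rewrite -subr_eq0 addrAC subrr add0r (negbTE u0).
rewrite [z0 + u - z0]addrAC subrr add0r => e e0.
have eu : 0 < e * nc u by rewrite mulr_gt0// nc_gt0.
have [N hN] := h2 u ur _ eu; exists N => n Nn.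
have := hN n.+1 (leqW Nn); rewrite big_nat_recl//= expr0 mulr1 -a0.
have -> : \sum_(0 <= i < n) a i.+1 * u ^+ i.+1 = u * \sum_(0 <= i < n) a i.+1 * u ^+ i.
  by rewrite mulr_sumr; apply: eq_bigr => i _; rewrite exprS mulrCA.
move: (\sum_(0 <= i < n) _) => S.
have -> : phi z0 + u * S - phi (z0 + u) = (S - (phi (z0 + u) - phi z0) / u) * u by field.
by rewrite ncM ler_pM2r// nc_gt0.
Qed.

Lemma wiener_small z0 r phi M : 0 < r -> wiener z0 r phi M -> forall eta, 0 < eta ->
  exists2 r', 0 < r' <= r & wiener z0 r' (fun z => phi z - phi z0) eta.
Proof.
move=> r0 h eta eta0; have M0 := wiener_ge0 h.
have [chi [hchi E]] := wiener_factor r0 h.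
have M1 : 0 < M / r + 1 by rewrite ltr_wpDl// divr_ge0// ltW.
have q0 : 0 < eta / (M / r + 1) by rewrite divr_gt0.
pose r' := Num.min r (eta / (M / r + 1)).
have r'0 : 0 < r' by rewrite lt_min r0 q0.
have r'r : r' <= r by rewrite ge_min lexx.
exists r'; first by rewrite r'0.
apply: (@wiener_le _ _ _ (r' * (M / r))).
  have : r' <= eta / (M / r + 1) by rewrite ge_min lexx orbT.
  rewrite ler_pdivlMr//; have := ltW r'0; lra.
apply: wiener_eq (wiener_shift (ltW r'0) (wiener_radius _ hchi)); last by rewrite (ltW r'0).
move=> u ur; rewrite E; last exact: le_trans ur r'r.
by rewrite [z0 + u - z0]addrAC subrr add0r; ring.
Qed.

Lemma wiener_limit0 z0 r k phi M : 0 < r -> wiener z0 r phi M ->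
  (forall eta, 0 < eta -> exists2 delta, 0 < delta & forall u, 0 < nc u < delta ->
     nc (phi (z0 + u)) <= eta * nc u ^+ k) -> phi z0 = 0.
Proof.
move=> r0 h ho; apply/eqP; rewrite -nc_eq0 eq_le nc_ge0 andbT.
apply/ler_addgt0Pr => e e0; rewrite add0r.
have [d d0 hd] := ho (e / 2) ltac:(lra).
have [r' /andP[r'0 r'r] hr'] := wiener_small r0 h (eta := e / 2) ltac:(lra).
pose s := Num.min (d / 2) (Num.min r' 1).
have s0 : 0 < s by rewrite !lt_min r'0 ltr01 divr_gt0.
have sd : s <= d / 2 by rewrite ge_min lexx.
have sr : s <= r' by rewrite !ge_min lexx orbT.
have s1 : s <= 1 by rewrite !ge_min lexx !orbT.
have sn : nc (s%:C : R[i]) = s by rewrite nc_real ger0_norm// ltW.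
have sd' : 0 < nc (s%:C : R[i]) < d by rewrite sn s0; lra.
have := hd _ sd'; rewrite sn => g2.
have := wiener_bound hr' (u := s%:C); rewrite sn => /(_ sr) g1.
have : s ^+ k <= 1 by rewrite exprn_ile1// ltW.
rewrite -(ler_pM2l (x := e / 2)); last by lra.
have := nc_sub_ge (phi z0) (phi (z0 + s%:C)); rewrite ncB in g1; lra.
Qed.

(** Being o(u^k) kills the coefficients 0 to k, which are divided out one at a time. *)
Lemma wiener_vanish z0 r k phi M : 0 < r -> wiener z0 r phi M ->
  (forall eta, 0 < eta -> exists2 delta, 0 < delta & forall u, 0 < nc u < delta ->
     nc (phi (z0 + u)) <= eta * nc u ^+ k) ->
  exists chi M', wiener z0 r chi M' /\
    forall u, nc u <= r -> phi (z0 + u) = u ^+ k.+1 * chi (z0 + u).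
Proof.
move=> r0; elim: k phi M => [|k IH] phi M h ho; have [chi [hchi E]] := wiener_factor r0 h;
  have phi0 := wiener_limit0 r0 h ho; rewrite phi0 in E.
  by exists chi, (M / r); split => // u ur; rewrite E// add0r expr1.
have [|chi' [M' [hchi' E']]] := IH chi _ hchi.
  move=> eta eta0; have [d d0 hd] := ho eta eta0.
  exists (Num.min d r); first by rewrite lt_min d0.
  move=> u; rewrite lt_min => /and3P[u0 ud ur].
  rewrite -(ler_pM2l u0) -ncM.
  have := hd u; rewrite u0 ud E ?(ltW ur)// add0r => /(_ isT)/le_trans; apply.
  by rewrite exprS; lra.
by exists chi', M'; split => // u ur; rewrite E// add0r E'// [u ^+ k.+2]exprS mulrA.
Qed.

End Wiener.

(** * Dynamics near the parabolic point *)

Section LocalForm.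
Variable R : realType.
Local Notation C := R[i].
Implicit Types (h : C -> C) (s z w : C).

(** Keeping s general treats the germ and its inverse together: s = 1 and s = -1 give the same cubic
    coefficient s^2 = 1. *)
Definition small_o3 h s := forall eta : R, 0 < eta -> exists2 delta : R, 0 < delta &
  forall u : C, 0 < nc u < delta -> nc (h u - (u + s * u ^+ 2 + u ^+ 3)) <= eta * nc u ^+ 3.

Lemma wiener_id (r : R) : 0 < r -> wiener (0 : C) r (fun z : C => z) r.
Proof.
move=> r0; have := wiener_shift (ltW r0) (wiener_cst (0 : C) (1 : C) (ltW r0)).
by rewrite nc1 mulr1; apply: wiener_eq => u _; rewrite mulr1 subr0.
Qed.

(** Analyticity upgrades the remainder from o(u^3) to O(u^4), which makes the error in the
    coordinate -s/w quadratic, hence summable along orbits. *)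
Lemma quartic_remainder h s : analytic_at h 0 -> small_o3 h s ->
  exists (r : R) (k : C -> C) (M : R), [/\ 0 < r, wiener 0 r k M &
    forall u, nc u <= r -> h u = u + s * u ^+ 2 + u ^+ 3 + u ^+ 4 * k u].
Proof.
move=> /analytic_wiener[r [M [r0 hW]]] ho.
have hid := wiener_id r0.
have hP := wiener_scale (-1) (wiener_add (ltW r0) (wiener_add (ltW r0) hid
  (wiener_scale s (wiener_exp 2 r0 hid))) (wiener_exp 3 r0 hid)).
have := wiener_add (ltW r0) hW hP => /(wiener_vanish (k := 3) r0)[|k [M' [kM E]]].
  move=> eta eta0; have [d d0 hd] := ho eta eta0; exists d => // u ud.
  by rewrite add0r mulN1r; exact: hd.
exists r, k, M'; split => // u ur; have := E u ur; rewrite !add0r => <-; ring.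
Qed.

(* In the coordinate [-s/w] the map is a translation up to [O(w^2)]; the term in
   [w] is absent because the coefficient of [z^3] is the square of that of [z^2]. *)
Lemma conjugate_form h s : s ^+ 2 = 1 -> analytic_at h 0 -> small_o3 h s ->
  exists (r : R) (K : C -> C) (M : R), [/\ 0 < r, wiener 0 r K M &
    forall w, w != 0 -> nc w <= r ->
      h w != 0 /\ - s / h w = - s / w + 1 + w ^+ 2 * K w].
Proof.
move=> s2 ha ho; have [r [k [M [r0 kM hE]]]] := quartic_remainder ha ho.
have hid := wiener_id r0.
pose Q1 w := s * w + w ^+ 2 + w ^+ 3 * k w.
have hQ := wiener_add (ltW r0) (wiener_add (ltW r0) (wiener_scale s hid) (wiener_exp 2 r0 hid))
  (wiener_mul r0 (wiener_exp 3 r0 hid) kM).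
(* h w = w (1 + Q1 w); norm at most 1/2 for Q1 makes 1 + Q1 invertible in the algebra. *)
have [r' /andP[r'0 r'r] hQ'] := wiener_small r0 hQ (eta := 2^-1) ltac:(by rewrite invr_gt0).
have {}hQ' : wiener 0 r' (fun w => (1 + Q1 w) - 1) 2^-1.
  apply: wiener_eq hQ' => u _; rewrite /Q1 mulr0 !expr0n /= mul0r !addr0 subr0; ring.
have hI := wiener_comp r'0 (@wiener_inv R 1 2^-1 ltac:(rewrite nc1; lra)) hQ' (lexx _).
have kM' : wiener 0 r' k M by apply: wiener_radius kM; rewrite (ltW r'0).
have hid' := wiener_id r'0.
have hN := wiener_scale s (wiener_add (ltW r'0) (wiener_add (ltW r'0) kM'
  (wiener_cst 0 (- s) (ltW r'0))) (wiener_scale (- s) (wiener_mul r'0 hid' kM'))).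
have hK := wiener_mul r'0 hN hI.
eexists r', _, _; split => //; first exact: hK.
move=> w w0 wr /=.
have Q0 : 1 + Q1 w != 0.
  rewrite -nc_gt0; have := wiener_bound hQ' wr; rewrite add0r.
  have := nc_add_ge 1 (Q1 w); rewrite nc1.
  have -> : 1 + Q1 w - 1 = Q1 w by ring.
  lra.
have hw : h w = w * (1 + Q1 w).
  by rewrite hE ?(le_trans wr)// /Q1; ring.
split; first by rewrite hw mulf_neq0.
have s3 : s ^+ 3 = s by rewrite exprS s2 mulr1.
rewrite hw; apply/eqP; rewrite -subr_eq0; apply/eqP.
have -> : - s / (w * (1 + Q1 w)) - (- s / w + 1 + w ^+ 2 *
   (s * (k w - s + - s * (w * k w)) * (1 + Q1 w)^-1)) =
   (- s - (- s + w + w ^+ 3 * 0) * (1 + Q1 w)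
     - w ^+ 3 * (s * (k w - s + - s * (w * k w)))) / (w * (1 + Q1 w)).
  by field; rewrite w0 Q0.
apply/eqP; rewrite mulf_eq0; apply/orP; left; apply/eqP.
(* The numerator is a multiple of s^2 - 1: here the relation between the quadratic and cubic
   coefficients enters. *)
have -> : - s - (- s + w + w ^+ 3 * 0) * (1 + Q1 w) - w ^+ 3 * (s * (k w - s + - s * (w * k w)))
  = (s ^+ 2 - 1) * (w + w ^+ 3 + w ^+ 4 * k w).
  by rewrite /Q1; ring.
by rewrite s2 subrr mul0r.
Qed.

End LocalForm.

(** * Orbits of a map close to the translation by 1 *)

Section NearTranslation.
Variable R : realType.
Local Notation C := R[i].
Implicit Types (z w : C).

Lemma ReDn (z : C) n : complex.Re (z + n%:R) = complex.Re z + n%:R.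
Proof.
have -> : (n%:R : C) = (n%:R : R)%:C by rewrite rmorph_nat.
by case: z.
Qed.

Lemma ImDn (z : C) n : complex.Im (z + n%:R) = complex.Im z.
Proof.
have -> : (n%:R : C) = (n%:R : R)%:C by rewrite rmorph_nat.
by case: z => a b /=; rewrite addr0.
Qed.

Lemma sum_inv_sqr (x : R) k : 1 < x ->
  \sum_(0 <= j < k) ((x + j%:R) ^+ 2)^-1 <= (x - 1)^-1.
Proof.
move=> x1.
suff : \sum_(0 <= j < k) ((x + j%:R) ^+ 2)^-1 <= (x - 1)^-1 - (x + k%:R - 1)^-1.
  have : 0 <= (x + k%:R - 1)^-1 by rewrite invr_ge0; have := ler0n R k; lra.
  lra.
elim: k => [|k IH]; first by rewrite big_geq// addr0 subrr.
rewrite big_nat_recr//= -natr1; have k0 := ler0n R k.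
move: (k%:R : R) k0 IH => y y0 IH.
suff : ((x + y) ^+ 2)^-1 <= (x + y - 1)^-1 - (x + (y + 1) - 1)^-1 by lra.
have -> : (x + y - 1)^-1 - (x + (y + 1) - 1)^-1 = ((x + y - 1) * (x + y))^-1.
  by field; rewrite !gt_eqF//; lra.
by rewrite lef_pV2 ?posrE ?exprn_gt0 ?mulr_gt0; nra.
Qed.

Variables (F K : C -> C) (s : C) (r M : R).
Hypotheses (r0 : 0 < r) (s2 : s ^+ 2 = 1) (KM : wiener 0 r K M).
Hypothesis FE : forall z, r^-1 <= nc z -> F z = z + 1 + (- s / z) ^+ 2 * K (- s / z).

Lemma nc_s : nc s = 1.
Proof.
have := congr1 (@Normc.normc R) s2; rewrite ncX nc1 => /eqP.
by rewrite sqrp_eq1 ?nc_ge0// => /eqP.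
Qed.

(** The bound with M keeps the accumulated deviation from the translation at most 1/4; the one with
    1/r keeps all iterates of a disc around z where [FE] applies; 8 gives numerical room. *)
Definition deep_point (z : C) := [/\ 8 <= complex.Re z, 8 * M <= complex.Re z
  & r^-1 + 1 <= complex.Re z].

Let M0 : 0 <= M. Proof. exact: wiener_ge0 KM. Qed.

Section DeepPoint.
Variable z0 : C.
Hypothesis dz : deep_point z0.
Let X := complex.Re z0 - 2^-1.
Let Xk k : r^-1 <= X + k%:R /\ 7 < X + k%:R.
Proof. by have [d1 d2 d3] := dz; have := ler0n R k; rewrite /X; lra. Qed.

(** One bootstrap step: a deviation of norm at most 1/2 controls the inverse of the iterate and
    keeps it in the domain of [FE]. *)
Lemma wiener_iter_inv_aux k m : m <= 2^-1 ->
  wiener z0 4^-1 (fun z => iter k F z - (z0 + k%:R)) m ->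
  wiener z0 4^-1 (fun z => (iter k F z)^-1) (X + k%:R)^-1 /\
  (forall u, nc u <= 4^-1 -> r^-1 <= nc (iter k F (z0 + u))).
Proof.
move=> m2 h; have [x1 x2] := Xk k; have m0 := wiener_ge0 h.
have cX : X + k%:R <= nc (z0 + k%:R) - 2^-1.
  by have := le_trans (ler_norm _) (Re_le_nc (z0 + k%:R)); rewrite ReDn /X; lra.
split.
  have q0 : (0 : R) < 4^-1 by rewrite invr_gt0.
  have hc : 0 <= (2^-1 : R) < nc (z0 + k%:R) by lra.
  apply: wiener_le (wiener_comp q0 (wiener_inv hc) h m2).
  by rewrite lef_pV2 ?posrE//; lra.
move=> u ur; have := wiener_bound h ur; have := nc_sub_ge (z0 + k%:R) (iter k F (z0 + u)).
by rewrite ncB; lra.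
Qed.

Lemma wiener_iter k :
  wiener z0 4^-1 (fun z => iter k F z - (z0 + k%:R)) 2^-1.
Proof.
have q0 : (0 : R) < 4^-1 by rewrite invr_gt0.
(* Sharper budget for the induction: 1/4 is the norm of z - z0, and step j adds at most M / (X +
   j)^2. A bare bound 1/2 would not reproduce itself. *)
pose m k := 4^-1 + M * \sum_(0 <= j < k) ((X + j%:R) ^+ 2)^-1.
have m2 j : m j <= 2^-1.
  have [x1 x2] := Xk 0; rewrite addr0 in x2.
  have := sum_inv_sqr j (x := X) ltac:(lra) => /(ler_wpM2l M0).
  suff : M * (X - 1)^-1 <= 4^-1 by rewrite /m; lra.
  by rewrite ler_pdivrMr; have [d1 d2 d3] := dz; rewrite /X; lra.
apply: (wiener_le (m2 k)); elim: k => [|k IH].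
  rewrite /m big_geq// mulr0 !addr0.
  have := wiener_shift (ltW q0) (wiener_cst z0 (1 : C) (ltW q0)).
  by rewrite nc1 mulr1; apply: wiener_eq => u _; rewrite /= mulr1.
have [hI far] := wiener_iter_inv_aux (m2 k) IH.
have hw := wiener_scale (- s) hI; rewrite normcN nc_s mul1r in hw.
have [x1 x2] := Xk k.
have hK : wiener z0 4^-1 (fun z => K (- s * (iter k F z)^-1)) M.
  apply: (wiener_comp q0 KM (m := (X + k%:R)^-1)).
    by apply: wiener_eq hw => u _; rewrite subr0.
  by rewrite -[r]invrK lef_pV2 ?posrE ?invr_gt0//; lra.
have hB := wiener_mul q0 (wiener_exp 2 q0 hw) hK.
have := wiener_add (ltW q0) IH hB.
have -> : m k + (X + k%:R)^-1 ^+ 2 * M = m k.+1.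
  by rewrite /m big_nat_recr//= exprVn; ring.
apply: wiener_eq => u ur; rewrite iterS FE ?far// -[k.+1%:R]natr1; ring.
Qed.

Lemma wiener_iter_inv k : wiener z0 4^-1 (fun z => (iter k F z)^-1) (X + k%:R)^-1.
Proof. exact: (wiener_iter_inv_aux (lexx _) (wiener_iter k)).1. Qed.

Lemma iter_far u k : nc u <= 4^-1 -> r^-1 <= nc (iter k F (z0 + u)).
Proof. exact: (wiener_iter_inv_aux (lexx _) (wiener_iter k)).2. Qed.

Lemma iter_near u k : nc u <= 4^-1 -> nc (iter k F (z0 + u) - (z0 + k%:R)) <= 2^-1.
Proof. exact: wiener_bound (wiener_iter k). Qed.

(** The difference of inverses is the difference of the iterates, of norm at most 1/2 + 1/2, times
    both inverses. The quadratic decay gives the normal convergence. *)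
Lemma wiener_iter_diff k :
  wiener z0 4^-1 (fun z => (iter k F z)^-1 - (iter k F z0)^-1) ((X + k%:R) ^+ 2)^-1.
Proof.
have q0 : (0 : R) < 4^-1 by rewrite invr_gt0.
have q0' : nc (0 : C) <= 4^-1 by rewrite nc0 ltW.
have [x1 x2] := Xk k.
have h0 := wiener_bound (wiener_iter_inv k) q0'; rewrite addr0 in h0.
have n0 := iter_near k q0'; rewrite addr0 in n0.
have hd := wiener_scale (-1) (wiener_add (ltW q0) (wiener_iter k)
  (wiener_cst z0 (z0 + k%:R - iter k F z0) (ltW q0))).
have hp := wiener_mul q0 (wiener_mul q0 hd (wiener_iter_inv k))
  (wiener_cst z0 (iter k F z0)^-1 (ltW q0)).
apply: (@wiener_le _ _ _ _ (nc (-1 : C) * (2^-1 + nc (z0 + k%:R - iter k F z0)) *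
  (X + k%:R)^-1 * nc (iter k F z0)^-1)).
  rewrite normcN nc1 mul1r -exprVn expr2 -mulrA ncB.
  have t0 : 0 < (X + k%:R)^-1 by rewrite invr_gt0; lra.
  have c0 := nc_ge0 (iter k F z0)^-1.
  have g0 := nc_ge0 (iter k F z0 - (z0 + k%:R)).
  rewrite -[X in _ <= X]mul1r; apply: ler_pM; rewrite ?mulr_ge0//; first lra.
  - exact: ltW.
  - by lra.
  - by rewrite ler_wpM2l// ltW.
apply: wiener_eq hp => u ur.
have r1 : 0 < r^-1 by rewrite invr_gt0.
have a0 : iter k F (z0 + u) != 0.
  by rewrite -nc_gt0; apply: lt_le_trans (iter_far k ur).
have b0 : iter k F z0 != 0.
  by rewrite -nc_gt0; have := iter_far k q0'; rewrite addr0; apply: lt_le_trans.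
by field; rewrite a0 b0.
Qed.

Lemma iter_diff_series T :
  (forall u, nc u <= 4^-1 -> clim (fun N => \sum_(0 <= k < N)
     ((iter k F (z0 + u))^-1 - (iter k F z0)^-1)) (T (z0 + u))) ->
  wiener z0 4^-1 T (X - 1)^-1.
Proof.
move=> hT; have [_] := Xk 0; rewrite addr0 => x2.
apply: (wiener_sum _ wiener_iter_diff) => //; last by move=> k; apply: sum_inv_sqr; lra.
Qed.

Lemma iter_diff_clim u : nc u <= 4^-1 -> exists T, clim (fun N => \sum_(0 <= k < N)
     ((iter k F (z0 + u))^-1 - (iter k F z0)^-1)) T.
Proof.
move=> ur; have [_] := Xk 0; rewrite addr0 => x2.
apply: (@abs_series_clim _ _ (X - 1)^-1) => N.
apply: le_trans (sum_inv_sqr N _); last by lra.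
by apply: ler_sum => k _; apply: wiener_bound (wiener_iter_diff k) ur.
Qed.

End DeepPoint.
Section Orbit.
Variable z0 : C.
Hypothesis dz : deep_point z0.
Local Notation zeta k := (iter k F z0).
Local Notation beta k := (zeta k.+1 - zeta k - 1).
Local Notation p k := (- s / zeta k).
Local Notation L := (nc z0 + 1).
Let q0 : nc (0 : C) <= 4^-1. Proof. by rewrite nc0 invr_ge0. Qed.

Lemma zeta_near k : nc (zeta k - (z0 + k%:R)) <= 2^-1.
Proof. by have := iter_near dz k q0; rewrite addr0. Qed.

Lemma Re_zeta k : complex.Re z0 + k%:R - 2^-1 <= complex.Re (zeta k).
Proof.
have := le_trans (Re_le_nc _) (zeta_near k); rewrite cReD cReN ReDn ler_norml.
by lra.
Qed.

Lemma Im_zeta k : `|complex.Im (zeta k)| <= `|complex.Im z0| + 2^-1.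
Proof.
have := le_trans (Im_le_nc _) (zeta_near k); rewrite cImD cImN ImDn => h.
by have := ler_normD (complex.Im (zeta k) - complex.Im z0) (complex.Im z0); rewrite subrK; lra.
Qed.

Lemma nc_zeta_ge k : complex.Re z0 + k%:R - 2^-1 <= nc (zeta k).
Proof. exact: le_trans (Re_zeta k) (le_trans (ler_norm _) (Re_le_nc _)). Qed.

Lemma nc_zeta_lower k : k.+1%:R <= nc (zeta k) /\ 7 <= nc (zeta k).
Proof.
have [d1 _ _] := dz; have := nc_zeta_ge k; have := ler0n R k.
by rewrite -[k.+1%:R]natr1; split; lra.
Qed.

Lemma nc_zeta_upper k : nc (zeta k) <= L * k.+1%:R.
Proof.
have kn : nc (k%:R : C) = k%:R.
  by rewrite -[in LHS](rmorph_nat (real_complex R)) nc_real ger0_norm.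
have := zeta_near k; have := nc_sub_ge (zeta k) (z0 + k%:R).
have := le_normcD z0 (k%:R : C); rewrite kn -[k.+1%:R]natr1.
by have := ler0n R k; have := nc_ge0 z0; nra.
Qed.

Lemma zeta_neq0 k : zeta k != 0.
Proof. by rewrite -nc_gt0; have [_] := nc_zeta_lower k; lra. Qed.

Lemma nc_beta k : nc (beta k) <= M * (nc (zeta k) ^+ 2)^-1.
Proof.
have fz : r^-1 <= nc (zeta k) by have := iter_far dz k q0; rewrite addr0.
rewrite iterS FE//.
have -> : zeta k + 1 + p k ^+ 2 * K (p k) - zeta k - 1 = p k ^+ 2 * K (p k) by ring.
have pk : nc (p k) = (nc (zeta k))^-1 by rewrite ncM normcN nc_s mul1r ncV.
rewrite ncM ncX pk exprVn mulrC ler_wpM2r ?invr_ge0 ?exprn_ge0 ?nc_ge0//.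
have := wiener_bound KM (u := p k); rewrite add0r; apply.
by rewrite pk -[r]invrK lef_pV2// posrE ?invr_gt0//; have [_] := nc_zeta_lower k; lra.
Qed.

Lemma nc_beta_small k : nc (beta k) <= 2^-1.
Proof.
apply: le_trans (nc_beta k) _; have [_ x7] := nc_zeta_lower k.
have [d1 d2 d3] := dz; have := nc_zeta_ge k; have := ler0n R k.
move: (nc (zeta k)) x7 => x x7 k0 xX.
by rewrite ler_pdivrMr ?exprn_gt0//; nra.
Qed.

Lemma nc_beta_omega k : nc (beta k) <= M * k.+1%:R^-1.
Proof.
apply: le_trans (nc_beta k) _; rewrite ler_wpM2l// lef_pV2 ?posrE ?exprn_gt0 ?nc_gt0 ?zeta_neq0//.
have [x1 _] := nc_zeta_lower k.
have y1 : 1 <= (k.+1%:R : R) by rewrite ler1n.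
by move: (k.+1%:R : R) (nc _) x1 y1 => y x x1 y1; nra.
Qed.

Lemma step_eq k : p k.+1 - p k = s * (1 + beta k) / (zeta k * zeta k.+1).
Proof.
have a0 := zeta_neq0 k; have b0 := zeta_neq0 k.+1.
move: (zeta k) (zeta k.+1) a0 b0 => a b a0 b0.
by field; rewrite a0 b0.
Qed.

Lemma nc_step_bounds k :
  2^-1 * (nc (zeta k) * nc (zeta k.+1))^-1 <= nc (p k.+1 - p k)
  <= 2 * (nc (zeta k) * nc (zeta k.+1))^-1.
Proof.
rewrite step_eq ncM ncV ncM nc_s mul1r ncM.
have t0 : 0 <= (nc (zeta k) * nc (zeta k.+1))^-1 by rewrite invr_ge0 mulr_ge0 ?nc_ge0.
have := nc_beta_small k => b2.
have := nc_add_ge 1 (beta k); have := le_normcD 1 (beta k); rewrite nc1 => h1 h2.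
by apply/andP; split; rewrite ler_wpM2r//; lra.
Qed.

Lemma step_omega k : (2 * L ^+ 2)^-1 * omega R k <= nc (p k.+1 - p k) <= 2 * omega R k.
Proof.
have /andP[h1 h2] := nc_step_bounds k.
have [a1 _] := nc_zeta_lower k; have [b1 _] := nc_zeta_lower k.+1.
have a2 := nc_zeta_upper k; have b2 := nc_zeta_upper k.+1.
have n0 : 0 < (k.+1%:R : R) by rewrite ltr0n.
have n1 : 0 < (k.+2%:R : R) by rewrite ltr0n.
have L0 : 0 < L by have := nc_ge0 z0; lra.
have x0 : 0 < nc (zeta k) by lra.
have y0 : 0 < nc (zeta k.+1) by lra.
apply/andP; split.
  apply: le_trans h1; rewrite /omega invfM -mulrA -invfM ler_pM2l ?invr_gt0//.
  rewrite lef_pV2 ?posrE ?mulr_gt0 ?exprn_gt0//.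
  apply: (le_trans (ler_pM (ltW x0) (ltW y0) a2 b2)).
  by rewrite le_eqVlt; apply/orP; left; apply/eqP; ring.
apply: le_trans h2 _; rewrite /omega ler_pM2l// lef_pV2 ?posrE ?mulr_gt0//.
by apply: ler_pM => //; exact: ltW.
Qed.

Lemma nc_zeta_succ k : 2^-1 * nc (zeta k) <= nc (zeta k.+1) <= 2 * nc (zeta k).
Proof.
have b2 := nc_beta_small k; have [_ x7] := nc_zeta_lower k.
have := nc_triangle (zeta k + 1) (zeta k.+1) 0.
have := nc_triangle (zeta k + 1) (zeta k) (- 1); have := le_normcD (zeta k) 1.
have := nc_sub_ge (zeta k) (- 1); rewrite !subr0 opprK normcN nc1.
have := nc_sub_ge (zeta k + 1) (zeta k.+1).
have -> : nc (zeta k.+1 - (zeta k + 1)) = nc (beta k) by congr nc; ring.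
have -> : nc (zeta k + 1 - zeta k.+1) = nc (beta k) by rewrite ncB; congr nc; ring.
move=> g1 g2 g3 g4 g5; apply/andP; split; lra.
Qed.

(** By [step_eq] the ratio is (1 + beta k) / (1 + beta k.+1) times zeta k.+2 / zeta k, where zeta
    k.+2 = zeta k + 2 + beta k + beta k.+1. The leading part 1 + 2 / zeta k is nearly real. *)
Lemma turning_eq k : (p k.+1 - p k) / (p k.+2 - p k.+1) - 1 - 2 / zeta k =
  (beta k - beta k.+1) / (1 + beta k.+1) * (1 + 2 / zeta k)
  + (1 + beta k) / (1 + beta k.+1) * ((beta k + beta k.+1) / zeta k).
Proof.
rewrite !step_eq.
have x0 := zeta_neq0 k; have y0 := zeta_neq0 k.+1; have w0 := zeta_neq0 k.+2.
have s0 : s != 0 by rewrite -nc_gt0 nc_s.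
have e1 : 1 + beta k.+1 != 0.
  rewrite -nc_gt0; have := nc_add_ge 1 (beta k.+1); rewrite nc1.
  by have := nc_beta_small k.+1; lra.
move: (zeta k) (zeta k.+1) (zeta k.+2) e1 x0 y0 w0 => x y w.
rewrite addrC subrK => e1 x0 y0 w0; rewrite ![1 + (_ - 1)]addrC !subrK.
by field; rewrite e1 x0 y0 w0 s0.
Qed.

Lemma turning k : nc ((p k.+1 - p k) / (p k.+2 - p k.+1) - 1 - 2 / zeta k)
  <= 40 * (M * (nc (zeta k) ^+ 2)^-1).
Proof.
rewrite turning_eq.
have b1 := nc_beta_small k; have b2 := nc_beta_small k.+1.
have B1 := nc_beta k; have B2 := nc_beta k.+1.
have [_ x7] := nc_zeta_lower k; have /andP[xx _] := nc_zeta_succ k.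
(* The factor 4 is due to |zeta k.+1| >= |zeta k| / 2; the final constant 40 is generous. *)
have {xx B2} B2 : nc (beta k.+1) <= 4 * (M * (nc (zeta k) ^+ 2)^-1).
  apply: (le_trans B2); rewrite mulrCA ler_wpM2l// -[4]invrK -invfM.
  by rewrite lef_pV2 ?posrE ?mulr_gt0 ?exprn_gt0 ?invr_gt0; nra.
have i1 : nc (1 + beta k.+1)^-1 <= 2.
  rewrite ncV -[2]invrK lef_pV2 ?posrE ?invr_gt0//.
    by have := nc_add_ge 1 (beta k.+1); rewrite nc1; lra.
  by have := nc_add_ge 1 (beta k.+1); rewrite nc1; lra.
have i2 : nc (zeta k)^-1 <= 7^-1 by rewrite ncV lef_pV2 ?posrE; lra.
have n2 : nc (2 : C) = 2.
  by rewrite -[in LHS](rmorph_nat (real_complex R)) nc_real ger0_norm.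
have Q0 : 0 <= M * (nc (zeta k) ^+ 2)^-1 by rewrite mulr_ge0 ?invr_ge0 ?exprn_ge0 ?nc_ge0.
move: (M * _) B1 B2 Q0 => Q B1 B2 Q0.
have i3 : nc (1 + 2 / zeta k) <= 9 / 7.
  by apply: (le_trans (le_normcD _ _)); rewrite nc1 ncM n2; lra.
have i4 : nc (1 + beta k) <= 3 / 2 by apply: (le_trans (le_normcD _ _)); rewrite nc1; lra.
have i5 : nc (beta k - beta k.+1) <= 5 * Q by apply: (le_trans (nc_subr _ _)); lra.
have i6 : nc (beta k + beta k.+1) <= 5 * Q by apply: (le_trans (le_normcD _ _)); lra.
apply: (le_trans (le_normcD _ _)); rewrite 5!ncM.
have j1 : nc (beta k - beta k.+1) * nc (1 + beta k.+1)^-1 <= 5 * Q * 2.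
  by apply: ler_pM; rewrite ?nc_ge0.
have j2 : nc (beta k - beta k.+1) * nc (1 + beta k.+1)^-1 * nc (1 + 2 / zeta k) <= 5 * Q * 2 * (9 / 7).
  by apply: ler_pM; rewrite ?mulr_ge0 ?nc_ge0.
have j3 : nc (1 + beta k) * nc (1 + beta k.+1)^-1 <= 3 / 2 * 2 by apply: ler_pM; rewrite ?nc_ge0.
have j4 : nc (beta k + beta k.+1) * nc (zeta k)^-1 <= 5 * Q * 7^-1 by apply: ler_pM; rewrite ?nc_ge0.
have j5 : nc (1 + beta k) * nc (1 + beta k.+1)^-1 * (nc (beta k + beta k.+1) * nc (zeta k)^-1) <= 3 / 2 * 2 * (5 * Q * 7^-1).
  by apply: ler_pM; rewrite ?mulr_ge0 ?nc_ge0.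
by apply: (le_trans (lerD j2 j5)); lra.
Qed.

Lemma Re_inv z : complex.Re z^-1 = complex.Re z / nc z ^+ 2.
Proof. by rewrite sqr_nc; case: z. Qed.

Lemma Im_inv z : complex.Im z^-1 = - (complex.Im z / nc z ^+ 2).
Proof. by rewrite sqr_nc; case: z. Qed.

Lemma nc_pE k : nc (p k) = (nc (zeta k))^-1.
Proof. by rewrite ncM normcN nc_s mul1r ncV. Qed.

(* The constant of proportionality between the turning of the orbit and its
   step; it depends on [z0] only through [Im z0], hence remains bounded along
   the orbit. *)
Definition turning_cst (z : C) := 4 * (2 * (`|complex.Im z| + 2^-1) + 40 * M).

(** The imaginary part is O(|zeta k|^-2) since Im (zeta k) stays bounded, and the step is at least
    |zeta k|^-2 / 4, whence the factor 4 in [turning_cst]. *)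
Lemma turning_bound k : 0 <= complex.Re ((p k.+1 - p k) / (p k.+2 - p k.+1)) /\
  `|complex.Im ((p k.+1 - p k) / (p k.+2 - p k.+1))| <= turning_cst z0 * nc (p k.+1 - p k).
Proof.
have := turning k; move: ((p k.+1 - p k) / (p k.+2 - p k.+1)) => rho hrho.
have [_ x7] := nc_zeta_lower k; have R0 := Re_zeta k; have I0 := Im_zeta k.
have [d1 d2 _] := dz; have k0 := ler0n R k.
have x0 : 0 < nc (zeta k) ^+ 2 by rewrite exprn_gt0//; lra.
have : rho = 1 + 2 / zeta k + (rho - 1 - 2 / zeta k) by ring.
move: (rho - 1 - 2 / zeta k) hrho => err hrho E.
have two z : complex.Re (2 * z) = 2 * complex.Re z /\ complex.Im (2 * z) = 2 * complex.Im z.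
  by rewrite -(rmorph_nat (real_complex R)) cReM cImM /=; lra.
have x1 : complex.Re z0 <= nc (zeta k) + 2^-1 by have := nc_zeta_ge k; lra.
split.
  rewrite E !cReD (two _).1 Re_inv.
  have r1 : 0 <= complex.Re (zeta k) / nc (zeta k) ^+ 2 by rewrite divr_ge0 ?ltW//; lra.
  have : 40 * (M * (nc (zeta k) ^+ 2)^-1) <= 1.
    rewrite mulrA ler_pdivrMr// mul1r; nra.
  have := le_trans (Re_le_nc _) hrho; rewrite ler_norml /= => /andP[h1 _] h2.
  by lra.
have /andP[h1 _] := nc_step_bounds k; have /andP[_ h2] := nc_zeta_succ k.
have t0 : 0 <= turning_cst z0.
  by rewrite mulr_ge0// addr_ge0 ?mulr_ge0// addr_ge0.
have h3 : 4^-1 * (nc (zeta k) ^+ 2)^-1 <= nc (p k.+1 - p k).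
  have p0 : 0 < nc (zeta k) by rewrite nc_gt0 zeta_neq0.
  have p1 : 0 < nc (zeta k.+1) by rewrite nc_gt0 zeta_neq0.
  apply: le_trans h1; rewrite -!invfM lef_pV2 ?posrE ?mulr_gt0//.
  by have := ler_wpM2l (ltW p0) h2; lra.
apply: (le_trans _ (ler_wpM2l t0 h3)).
have -> : turning_cst z0 * (4^-1 * (nc (zeta k) ^+ 2)^-1) =
  2 * ((`|complex.Im z0| + 2^-1) * (nc (zeta k) ^+ 2)^-1) + 40 * (M * (nc (zeta k) ^+ 2)^-1).
  by rewrite /turning_cst; move: ((nc (zeta k) ^+ 2)^-1) => y; field.
rewrite {1}E !cImD (two _).2 Im_inv /= add0r.
apply: (le_trans (ler_normD _ _)); apply: lerD; last exact: le_trans (Im_le_nc _) hrho.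
rewrite normrM normrN normrM [`|2|]ger0_norm// ler_pM2l//.
by rewrite [`|(_ ^+ 2)^-1|]ger0_norm ?invr_ge0 ?(ltW x0)// ler_wpM2r ?invr_ge0 ?(ltW x0).
Qed.

Lemma deep_harmonic (b B : R) : 8 * turning_cst z0 + 1 <= complex.Re z0 ->
  0 < b <= (2 * L ^+ 2)^-1 -> 2 <= B -> harmonic_orbit (fun k => p k) b B.
Proof.
move=> ht /andP[b0 bL] B2; have [d1 _ _] := dz.
have t0 : 0 <= turning_cst z0.
  by rewrite mulr_ge0// addr_ge0 ?mulr_ge0// addr_ge0.
split => //.
- by lra.
- move=> k; rewrite nc_pE; have [x1 x7] := nc_zeta_lower k.
  have n0 : 0 < (k.+1%:R : R) by rewrite ltr0n.
  apply: (@le_trans _ _ k.+1%:R^-1); first by rewrite lef_pV2 ?posrE//; lra.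
  by rewrite ler_peMl ?invr_ge0 ?(ltW n0)//; lra.
- move=> k; have /andP[h1 h2] := step_omega k; have w0 := omega_gt0 R k.
  by rewrite (le_trans _ h1) ?(le_trans h2)// ler_wpM2r// ltW.
(* With C the turning constant and r = 1 / (Re z0 - 1/2), the hypothesis on Re z0 gives 4 C r <= 1/2
   and this choice gives 2 C e < 1/2, so C (4 r + 2 e) < 1. *)
- exists (4 * turning_cst z0 + 4)^-1; first by rewrite invr_gt0; lra.
  move=> e /andP[e0 ee].
  apply: (@nested_of_slow_turning _ _ _ (complex.Re z0 - 2^-1)^-1 (turning_cst z0)) => //.
  + move=> k; rewrite -subr_eq0 -nc_gt0; have /andP[h1 _] := nc_step_bounds k.
    by apply: lt_le_trans h1; rewrite mulr_gt0 ?invr_gt0 ?mulr_gt0 ?nc_gt0 ?zeta_neq0.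
  + move=> k; rewrite nc_pE lef_pV2 ?posrE ?nc_gt0 ?zeta_neq0//; last by lra.
    by have := nc_zeta_ge k; have := ler0n R k; lra.
  + have h1 : turning_cst z0 * (complex.Re z0 - 2^-1)^-1 <= 8^-1.
      by rewrite ler_pdivrMr; lra.
    have h2 : e * (4 * turning_cst z0 + 4) < 1.
      by rewrite -ltr_pdivlMr ?mul1r//; lra.
    by move: (_^-1) h1 => y h1; lra.
  + exact: turning_bound.
Qed.

(** Re (zeta k) >= k + 1 while |zeta k| <= L (k + 1). Compared with the harmonic series, this makes
    the sum of the real parts diverge. *)
Lemma Re_inv_zeta_lower k : (L ^+ 2)^-1 * k.+1%:R^-1 <= complex.Re (zeta k)^-1.
Proof.
rewrite Re_inv; have [x1 x7] := nc_zeta_lower k; have xu := nc_zeta_upper k.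
have n0 : 0 < (k.+1%:R : R) by rewrite ltr0n.
have L0 : 0 < L by have := nc_ge0 z0; lra.
have R1 : k.+1%:R <= complex.Re (zeta k).
  by have := Re_zeta k; have [d1 _ _] := dz; rewrite -[k.+1%:R]natr1; lra.
apply: (@le_trans _ _ (k.+1%:R * (nc (zeta k) ^+ 2)^-1)); last first.
  by rewrite ler_wpM2r// invr_ge0 exprn_ge0 ?nc_ge0.
apply: (@le_trans _ _ (k.+1%:R * ((L * k.+1%:R) ^+ 2)^-1)).
  rewrite le_eqVlt; apply/orP; left; apply/eqP; clear x1 xu R1.
  move: (k.+1%:R : R) L n0 L0 => n l n0 l0.
  by field; rewrite !gt_eqF.
rewrite ler_pM2l// lef_pV2 ?posrE ?exprn_gt0 ?mulr_gt0 ?nc_gt0 ?zeta_neq0//.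
by apply: lerXn2r; rewrite ?nnegrE ?nc_ge0 ?mulr_ge0 ?(ltW L0).
Qed.

End Orbit.

(** * Distance between two orbits and between their steps *)

Section TwoOrbits.
Variables z0 z1 : C.
Hypotheses (dz0 : deep_point z0) (dz1 : deep_point z1).
Local Notation p z k := (- s / iter k F z).
Let d := nc (z0 - z1) + 1.

Lemma orbits_close k : nc (iter k F z0 - iter k F z1) <= d.
Proof.
have := zeta_near dz0 k; have := zeta_near dz1 k.
have := nc_triangle (z0 + k%:R) (iter k F z0) (iter k F z1).
have := nc_triangle (z1 + k%:R) (z0 + k%:R) (iter k F z1).
have -> : z0 + k%:R - (z1 + k%:R) = z0 - z1 by ring.
by rewrite [nc (z1 + _ - _)]ncB /d; lra.
Qed.

Lemma nc_inv_le (x : C) n : n.+1%:R <= nc x -> nc x^-1 <= n.+1%:R^-1.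
Proof.
move=> h; have n0 : 0 < (n.+1%:R : R) by rewrite ltr0n.
by rewrite ncV lef_pV2 ?posrE//; lra.
Qed.

Lemma orbit_diff k : nc (p z0 k - p z1 k) <= (2 * d + 2 * M) * omega R k.
Proof.
have a0 := zeta_neq0 dz0 k; have b0 := zeta_neq0 dz1 k.
have [/nc_inv_le a1 _] := nc_zeta_lower dz0 k; have [/nc_inv_le b1 _] := nc_zeta_lower dz1 k.
have -> : p z0 k - p z1 k = s * (iter k F z0 - iter k F z1) * ((iter k F z0)^-1 * (iter k F z1)^-1).
  by field; rewrite a0 b0.
rewrite ncM ncM nc_s mul1r ncM.
have d0 : 0 <= d by rewrite /d; have := nc_ge0 (z0 - z1); lra.
apply: (@le_trans _ _ (d * (k.+1%:R^-1 * k.+1%:R^-1))).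
  by apply: ler_pM; rewrite ?mulr_ge0 ?nc_ge0 ?orbits_close//; apply: ler_pM; rewrite ?nc_ge0.
have := sqr_inv_le_omega R k; rewrite expr2 => /(ler_wpM2l d0).
move=> /le_trans; apply; rewrite mulrA [d * 2]mulrC ler_wpM2r ?(ltW (omega_gt0 R k))//.
by rewrite lerDl mulr_ge0.
Qed.

(** Changing one factor of [step_eq] at a time, every term gets three inverse factors of order 1/k,
    the deviations [beta] supplying one of their own: one more than [orbit_diff]. *)
Lemma step_diff k : nc ((p z0 k.+1 - p z0 k) - (p z1 k.+1 - p z1 k)) <=
  (2 * d + 2 * M) * omega R k * k.+1%:R^-1.
Proof.
have a0 := zeta_neq0 dz0 k; have b0 := zeta_neq0 dz1 k.
have a1 := zeta_neq0 dz0 k.+1; have b1 := zeta_neq0 dz1 k.+1.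
have [/nc_inv_le A0 _] := nc_zeta_lower dz0 k; have [/nc_inv_le B0 _] := nc_zeta_lower dz1 k.
have [/nc_inv_le A1 _] := nc_zeta_lower dz0 k.+1; have [/nc_inv_le B1 _] := nc_zeta_lower dz1 k.+1.
have e0 := orbits_close k; have e1 := orbits_close k.+1.
have m0 := nc_beta_omega dz0 k; have m1 := nc_beta_omega dz1 k.
rewrite !step_eq//.
pose b z := iter k.+1 F z - iter k F z - 1.
rewrite -![iter k.+1 F _ - iter k F _ - 1]/(b _) in m0 m1 *.
have -> : s * (1 + b z0) / (iter k F z0 * iter k.+1 F z0) -
   s * (1 + b z1) / (iter k F z1 * iter k.+1 F z1) =
  s * (- (iter k F z0 - iter k F z1) * ((iter k F z0)^-1 * (iter k.+1 F z0)^-1 * (iter k F z1)^-1)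
     - (iter k.+1 F z0 - iter k.+1 F z1) * ((iter k F z1)^-1 * (iter k.+1 F z1)^-1 * (iter k.+1 F z0)^-1)
     + (b z0 * ((iter k F z0)^-1 * (iter k.+1 F z0)^-1) - b z1 * ((iter k F z1)^-1 * (iter k.+1 F z1)^-1))).
  move: (b z0) (b z1) (iter k F z0) (iter k F z1) (iter k.+1 F z0) (iter k.+1 F z1) a0 b0 a1 b1.
  by move=> u v x y x' y' x0 y0 x'0 y'0; field; rewrite x0 y0 x'0 y'0.
rewrite ncM nc_s mul1r.
have d0 : 0 <= d by rewrite /d; have := nc_ge0 (z0 - z1); lra.
have n0 : 0 <= (k.+1%:R^-1 : R) by rewrite invr_ge0.
have n1 : 0 <= (k.+2%:R^-1 : R) by rewrite invr_ge0.
have n10 : (k.+2%:R^-1 : R) <= k.+1%:R^-1 by rewrite lef_pV2 ?posrE ?ltr0n// ler_nat.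
have -> : omega R k = k.+1%:R^-1 * k.+2%:R^-1 by rewrite /omega invfM.
move: (b z0) (b z1) (iter k F z0)^-1 (iter k F z1)^-1 (iter k.+1 F z0)^-1 (iter k.+1 F z1)^-1 A0 B0 A1 B1
  m0 m1 e0 e1 => u v x y x' y' x0 y0 x'0 y'0 hu hv hd hd'.
move: (iter k F z0 - _) (iter k.+1 F z0 - _) hd hd' => D D' hd hd'.
move: (k.+1%:R^-1 : R) (k.+2%:R^-1 : R) n0 n1 n10 x0 y0 x'0 y'0 hu hv => n m n0 m0 mn x0 y0 x'0 y'0 hu hv.
have t1 : nc (- D * (x * x' * y)) <= d * (n * m * n).
  rewrite ncM normcN !ncM; apply: ler_pM; rewrite ?mulr_ge0 ?nc_ge0//.
  by apply: ler_pM; rewrite ?mulr_ge0 ?nc_ge0//; apply: ler_pM; rewrite ?nc_ge0.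
have t2 : nc (D' * (y * y' * x')) <= d * (n * m * n).
  rewrite !ncM; apply: ler_pM; rewrite ?mulr_ge0 ?nc_ge0//.
  apply: ler_pM; rewrite ?mulr_ge0 ?nc_ge0//; last exact: le_trans mn.
  by apply: ler_pM; rewrite ?nc_ge0.
have t3 : nc (u * (x * x')) <= M * n * (n * m).
  by rewrite !ncM; apply: ler_pM; rewrite ?mulr_ge0 ?nc_ge0//; apply: ler_pM; rewrite ?nc_ge0.
have t4 : nc (v * (y * y')) <= M * n * (n * m).
  by rewrite !ncM; apply: ler_pM; rewrite ?mulr_ge0 ?nc_ge0//; apply: ler_pM; rewrite ?nc_ge0.
apply: (le_trans (le_normcD _ _)).
have := nc_subr (- D * (x * x' * y)) (D' * (y * y' * x')).
have := nc_subr (u * (x * x')) (v * (y * y')).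
by lra.
Qed.

End TwoOrbits.
End NearTranslation.

(** * Germs and their principal parts *)

Section Germs.
Variable R : realType.
Local Notation C := R[i].
Implicit Types (f g : C -> C).

Lemma small_o3_jet3 f : jet3 f -> small_o3 f 1.
Proof.
move=> /eqoP hf eta eta0.
have [|d d0 hd] := (near_nc _ _).1 (hf eta%:C _); first by rewrite ltcR.
exists d => // u /andP[_ ud]; have := hd u; rewrite subr0 mul1r => /(_ ud).
by rewrite -[`|u ^+ 3|]/((nc (u ^+ 3))%:C) -rmorphM norm_lec ncX.
Qed.

Lemma analytic_continuous f z0 : analytic_at f z0 -> forall e : R, 0 < e ->
  exists2 d : R, 0 < d & forall z, nc (z - z0) < d -> nc (f z - f z0) <= e.
Proof.
move=> /analytic_wiener[r [M [r0 h]]] e e0.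
have [r' /andP[r'0 _] h'] := wiener_small r0 h e0.
by exists r' => // z /ltW zr; exact: (wiener_bound' h' zr).
Qed.

Lemma analytic_eq f g z0 (d : R) : 0 < d -> (forall z, nc (z - z0) < d -> f z = g z) ->
  analytic_at f z0 -> analytic_at g z0.
Proof.
move=> d0 fg /analytic_wiener[r [M [r0 h]]].
pose r' := Num.min r (d / 2).
have r'0 : 0 < r' by rewrite lt_min r0 divr_gt0.
apply: (@wiener_analytic _ z0 r' g M) => //.
apply: wiener_eq (wiener_radius _ h); last by rewrite (ltW r'0) ge_min lexx.
move=> u; rewrite le_min => /andP[_ ud]; apply: fg.
by rewrite [z0 + u - z0]addrAC subrr add0r; lra.
Qed.

Lemma analytic_cst c z0 : analytic_at (fun _ : C => c) z0.
Proof. exact: wiener_analytic ltr01 (wiener_cst z0 c ler01). Qed.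

Lemma analytic_id z0 : analytic_at (fun z : C => z) z0.
Proof.
have h := wiener_shift ler01 (wiener_cst z0 (1 : C) (@ler01 R)).
have := wiener_add ler01 h (wiener_cst z0 z0 (@ler01 R)) => h'.
apply: (analytic_eq ltr01) (wiener_analytic ltr01 h') => z _.
by rewrite mulr1 subrK.
Qed.

Lemma analytic_add f g z0 : analytic_at f z0 -> analytic_at g z0 ->
  analytic_at (fun z => f z + g z) z0.
Proof.
move=> /analytic_wiener[r [M [r0 h]]] /analytic_wiener[r' [M' [r'0 h']]].
have m0 : 0 < Num.min r r' by rewrite lt_min r0.
have m1 : 0 <= Num.min r r' <= r by rewrite (ltW m0) ge_min lexx.
have m2 : 0 <= Num.min r r' <= r' by rewrite (ltW m0) ge_min lexx orbT.
exact: wiener_analytic m0 (wiener_add (ltW m0) (wiener_radius m1 h) (wiener_radius m2 h')).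
Qed.

Lemma analytic_scale c f z0 : analytic_at f z0 -> analytic_at (fun z => c * f z) z0.
Proof.
move=> /analytic_wiener[r [M [r0 h]]]; exact: wiener_analytic r0 (wiener_scale c h).
Qed.

Lemma analytic_sum (F : nat -> C -> C) m z0 : (forall n, analytic_at (F n) z0) ->
  analytic_at (fun z => \sum_(0 <= n < m) F n z) z0.
Proof.
move=> h; elim: m => [|m IH].
  by apply: (analytic_eq ltr01) (analytic_cst 0 z0) => z _; rewrite big_geq.
by apply: (analytic_eq ltr01) (analytic_add IH (h m)) => z _; rewrite big_nat_recr.
Qed.

Lemma analytic_comp f g z0 : analytic_at f (g z0) -> analytic_at g z0 ->
  analytic_at (fun z => f (g z)) z0.
Proof.
move=> /analytic_wiener[r [M [r0 h]]] /analytic_wiener[r' [M' [r'0 h']]].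
have [q /andP[q0 _] hq] := wiener_small r'0 h' r0.
exact: wiener_analytic q0 (wiener_comp q0 h hq (lexx _)).
Qed.

Lemma analytic_inv z0 : z0 != 0 -> analytic_at (fun z : C => z^-1) z0.
Proof.
rewrite -nc_gt0 => z00; have s0 : 0 < nc z0 / 2 by rewrite divr_gt0.
have s1 : 0 <= nc z0 / 2 < nc z0 by lra.
exact: wiener_analytic s0 (wiener_inv s1).
Qed.

(** * The cubic jet of the inverse germ *)

Section InverseJet.
Variables (u k : C) (M : R).
Hypotheses (u8 : nc u <= 8^-1) (kM : nc k <= M) (uM : nc u * M <= 8^-1).
Let w := u + u ^+ 2 + u ^+ 3 + u ^+ 4 * k.
Let a := u + u ^+ 2 + u ^+ 3.

Let x0 : 0 <= nc u. Proof. exact: nc_ge0. Qed.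

Let x2 : nc u ^+ 2 <= 8^-1.
Proof.
rewrite expr2; apply: le_trans u8; rewrite ler_piMr//.
by apply: (le_trans u8); rewrite invf_le1// ler1n.
Qed.

Let x3 : nc u ^+ 3 <= 8^-1.
Proof.
rewrite exprSr; apply: le_trans x2; rewrite ler_piMr ?exprn_ge0//.
by apply: (le_trans u8); rewrite invf_le1// ler1n.
Qed.

Lemma inverse_jet_factor : exists2 v, w = u * (1 + v) & nc v <= 2^-1.
Proof.
exists (u + u ^+ 2 + u ^+ 2 * (u * k)); first by rewrite /w; ring.
have h1 : nc (u ^+ 2 * (u * k)) <= 8^-1.
  rewrite ncM ncX ncM -[X in _ <= X]mul1r; apply: ler_pM.
  - exact: exprn_ge0.
  - by rewrite mulr_ge0 ?nc_ge0.
  - by apply: (le_trans x2); rewrite invf_le1// ler1n.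
  - by apply: le_trans uM; rewrite ler_wpM2l.
have h2 := le_normcD (u + u ^+ 2) (u ^+ 2 * (u * k)); have h3 := le_normcD u (u ^+ 2).
rewrite ncX in h3; move: u8 x2 h1 h2 h3; lra.
Qed.

Lemma inverse_jet_lower : 2^-1 * nc u <= nc w.
Proof.
have [v -> vb] := inverse_jet_factor; rewrite ncM mulrC ler_wpM2l//.
by have := nc_add_ge 1 v; rewrite nc1; move: vb; lra.
Qed.

Let w1 : nc w <= 1.
Proof.
have [v -> vb] := inverse_jet_factor; rewrite ncM -[X in _ <= X](@mulVf _ 8) ?pnatr_eq0//.
apply: ler_pM => //; first exact: nc_ge0.
by have := le_normcD 1 v; rewrite nc1; move: vb; lra.
Qed.

Let a1 : nc a <= 1.
Proof.
have := le_normcD (u + u ^+ 2) (u ^+ 3); have := le_normcD u (u ^+ 2).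
by rewrite !ncX -/a; move: u8 x2 x3; lra.
Qed.

(** Determined by a - a^2 + a^3 = u + u^4 b; its coefficients sum to 20. *)
Let b := u * (4 + u * (6 + u * (6 + u * (3 + u)))).

Let nc_nat (n : nat) : nc (n%:R : C) = n%:R.
Proof. by rewrite -[in LHS](rmorph_nat (real_complex R)) nc_real ger0_norm. Qed.

Let bound_step (z z' : C) (m m' : R) : nc z <= m -> nc z' <= m' -> nc (z + u * z') <= m + m'.
Proof.
move=> h h'; apply: (le_trans (le_normcD _ _)); apply: lerD => //; rewrite ncM.
rewrite -[X in _ <= X]mul1r; apply: ler_pM; rewrite ?nc_ge0//.
by apply: (le_trans u8); rewrite invf_le1// ler1n.
Qed.

Let b20 : nc b <= 20.
Proof.
have s1 : nc (3 + u) <= 3 + 1.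
  apply: (le_trans (le_normcD _ _)); rewrite nc_nat lerD2l.
  by apply: (le_trans u8); rewrite invf_le1// ler1n.
have s2 := bound_step (_ : nc 6 <= 6) s1; have s3 := bound_step (_ : nc 6 <= 6) (s2 _).
have s4 := bound_step (_ : nc 4 <= 4) (s3 _ _).
have := bound_step (_ : nc 0 <= 0) (s4 _ _ _); rewrite add0r add0r !nc_nat nc0 -/b.
move=> /(_ (lexx _) (lexx _) (lexx _) (lexx _)) => /le_trans; apply; lra.
Qed.

(** The polynomial w - w^2 + w^3 inverts a up to u^4 b, and replacing w by a costs u^4 k times a
    factor bounded by 1 + 2 + 3. *)
Lemma inverse_jet_error : nc (u - (w - w ^+ 2 + w ^+ 3)) <= (6 * M + 20) * nc u ^+ 4.
Proof.
have -> : u - (w - w ^+ 2 + w ^+ 3) =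
    - u ^+ 4 * (k * (1 - (w + a) + (w * w + w * a + a * a)) + b).
  by rewrite /w /a /b; ring.
rewrite ncM normcN ncX mulrC ler_wpM2r ?exprn_ge0//.
apply: (le_trans (le_normcD _ _)); apply: lerD => //; rewrite ncM mulrC.
apply: ler_pM => //; rewrite ?nc_ge0//.
have le1 (z z' : C) : nc z <= 1 -> nc z' <= 1 -> nc (z * z') <= 1.
  by move=> h h'; rewrite ncM -[X in _ <= X]mulr1; apply: ler_pM; rewrite ?nc_ge0.
have := le1 _ _ w1 w1; have := le1 _ _ w1 a1; have := le1 _ _ a1 a1.
have := le_normcD (1 - (w + a)) (w * w + w * a + a * a).
have := nc_subr 1 (w + a); rewrite nc1; have := le_normcD w a.
have := le_normcD (w * w + w * a) (a * a); have := le_normcD (w * w) (w * a).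
by move: w1 a1; lra.
Qed.

End InverseJet.

Lemma small_o3_inverse f g (U : set C) : open U -> U 0 -> open (f @` U) -> f 0 = 0 ->
  analytic_at f 0 -> analytic_at g 0 -> (forall z, U z -> g (f z) = z) ->
  small_o3 f 1 -> small_o3 g (-1).
Proof.
move=> oU U0 oV f0 af ag gf ho eta eta0.
have [r [k [M [r0 kM fE]]]] := quartic_remainder af ho.
have M0 := wiener_ge0 kM.
have V0 : (f @` U) 0 by exists 0.
have [d d0 hd] := (near_nc _ _).1 (open_nbhs_nbhs (conj oV V0)).
have g0 : g 0 = 0 by rewrite -{1}f0 gf.
pose c : R := 6 * M + 20.
have c0 : 0 < c by rewrite /c; lra.
(* The first three bounds on u = g w meet the hypotheses of [inverse_jet_error]. The last turns c
   |u|^4 into eta |w|^3, with 8 = 2^3 from |u| <= 2 |w|. *)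
pose q := Num.min r (Num.min (8^-1) (Num.min ((8 * (M + 1))^-1) (eta / (8 * c)))).
have M1 : 0 < M + 1 by lra.
have M8 : 0 < (8 * (M + 1))^-1 by rewrite invr_gt0 mulr_gt0.
have c8 : 0 < eta / (8 * c) by rewrite divr_gt0// mulr_gt0.
have q0 : 0 < q by rewrite !lt_min r0 M8 c8 invr_gt0 ltr0n.
have [d' d'0 hd'] := analytic_continuous ag q0.
exists (Num.min d d'); first by rewrite lt_min d0 d'0.
move=> w; rewrite lt_min => /and3P[w0 wd wd'].
have [u Uu uw] : (f @` U) w by apply: hd; rewrite subr0.
have gw : g w = u by rewrite -uw gf.
have := hd' w; rewrite subr0 g0 subr0 gw => /(_ wd').
rewrite !le_min => /and4P[ur u8 uM ue].
have {kM} kM : nc (k u) <= M by have := wiener_bound kM ur; rewrite add0r.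
have {}uM : nc u * M <= 8^-1.
  apply: (le_trans (ler_wpM2r M0 uM)); rewrite invfM -mulrA ler_piMr//.
  by rewrite mulrC ler_pdivrMr// mul1r lerDl.
have {fE} wE : w = u + u ^+ 2 + u ^+ 3 + u ^+ 4 * k u by rewrite -uw fE// mul1r.
have := inverse_jet_error u8 kM uM; have := inverse_jet_lower u8 kM uM.
rewrite -wE mulN1r => wl; rewrite -/c => /le_trans; apply.
have h4 : nc u ^+ 4 <= nc u * (8 * nc w ^+ 3).
  rewrite exprS ler_wpM2l ?nc_ge0//.
  have : nc u <= 2 * nc w by move: wl; lra.
  move=> /(@lerXn2r _ 3 _ _); rewrite !nnegrE nc_ge0 mulr_ge0 ?nc_ge0// => /(_ isT isT).
  by rewrite exprMn -natrX.
apply: (le_trans (ler_wpM2l (ltW c0) h4)).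
have -> : c * (nc u * (8 * nc w ^+ 3)) = nc u * (8 * c) * nc w ^+ 3 by ring.
by rewrite ler_wpM2r ?exprn_ge0 ?nc_ge0// -ler_pdivlMr// mulr_gt0.
Qed.

End Germs.

Section EqualUpToOrder.
Variable R : realType.
Local Notation C := R[i].

Definition order2_coef (D : R -> C) (c : C) := forall eta : R, 0 < eta ->
  exists2 delta, 0 < delta & forall e, 0 < e < delta -> nc (D e - (e ^+ 2)%:C * c) <= eta * e ^+ 2.

(** The comparison of orbits gives a coefficient only up to a tolerance for each N; this bounds its
    distance to the true one. *)
Lemma order2_coef_near (D : R -> C) (c c' : C) (eta : R) : 0 < eta -> order2_coef D c ->
  (exists2 delta, 0 < delta & forall e, 0 < e < delta -> nc (D e - (e ^+ 2)%:C * c') <= eta * e ^+ 2) ->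
  nc (c - c') <= 2 * eta.
Proof.
move=> eta0 hc [d' d'0 hd']; have [d d0 hd] := hc eta eta0.
pose e := Num.min d d' / 2; have m0 : 0 < Num.min d d' by rewrite lt_min d0.
have e0 : 0 < e by rewrite divr_gt0.
have em : e < Num.min d d' by rewrite /e; lra.
move: em; rewrite lt_min => /andP[ed ed'].
have := hd e; have := hd' e; rewrite e0 ed ed' => /(_ isT) h' /(_ isT) h.
have e2 : 0 < e ^+ 2 by rewrite exprn_gt0.
rewrite -(ler_pM2r e2).
have -> : nc (c - c') * e ^+ 2 = nc ((D e - (e ^+ 2)%:C * c') - (D e - (e ^+ 2)%:C * c)).
  rewrite -[X in _ * X]ger0_norm ?(ltW e2)// -nc_real -ncM; congr nc; ring.
by apply: (le_trans (nc_subr _ _)); lra.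
Qed.

Lemma order2_coef_unique (D : R -> C) (c c' : C) : order2_coef D c -> order2_coef D c' -> c = c'.
Proof.
move=> hc hc'; apply/eqP; rewrite -subr_eq0 -nc_eq0 eq_le nc_ge0 andbT.
apply/ler_addgt0Pr => e e0; rewrite add0r.
have -> : e = 2 * (e / 2) by field.
by apply: (order2_coef_near _ hc); [lra|apply: hc'; lra].
Qed.


End EqualUpToOrder.

(** * Functional equation and analyticity of the principal part *)

Section PrincipalPart.
Variable R : realType.
Local Notation C := R[i].
Variables (h : C -> C) (V : set C) (H : C -> C) (s : C).
Hypotheses (s2 : s ^+ 2 = 1) (oV : open V) (aV : forall z, V z -> analytic_at h z).
Hypotheses (a0 : analytic_at h 0) (h0 : h 0 = 0) (ho3 : small_o3 h s).
Hypotheses (hV : forall z, V z -> V (h z)) (h_inj0 : forall z, V z -> h z = 0 -> z = 0).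
Hypothesis (hcvg : forall z, V z -> iter n h z @[n --> \oo] --> (0 : C)).
Hypothesis (hpp : principal_part h V H).
Local Notation area_moment z e := (complex_measure (eps_nbhd (forward_orbit h z) e)).

Lemma orbit_nbhdE z e : eps_nbhd (forward_orbit h z) e = tail_nbhd (fun n => iter n h z) e 0.
Proof.
apply/seteqP; split => w.
  by move=> [_ [n _ <-]]; rewrite norm_ltc => wn; exists n.
by move=> [n _ wn]; exists (iter n h z); [exists n|rewrite norm_ltc].
Qed.

Lemma iterV z n : V z -> V (iter n h z).
Proof. by move=> Vz; elim: n => //= n; exact: hV. Qed.

Lemma iter_neq0 z n : V z -> z != 0 -> iter n h z != 0.
Proof.
move=> Vz z0; elim: n => //= n; apply: contra_neq; apply: h_inj0; exact: iterV.
Qed.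

Lemma orbit_small z : V z -> forall e : R, 0 < e -> exists N, forall n, (N <= n)%N -> nc (iter n h z) <= e.
Proof.
move=> Vz e e0; have /cvg_clim/(_ e e0)[N hN] := hcvg Vz.
by exists N => n Nn; have := hN n Nn; rewrite subr0.
Qed.

Lemma orbit_bounded z : V z -> exists B : R, forall n, nc (iter n h z) <= B.
Proof.
move=> Vz; have [N hN] := orbit_small Vz ltr01.
exists (\sum_(0 <= n < N) nc (iter n h z) + 1) => n.
have S0 i j : 0 <= \sum_(i <= k < j) nc (iter k h z) by rewrite sumr_ge0// => k _; exact: nc_ge0.
have [/hN|nN] := leqP N n; first by have := S0 0%N N; lra.
rewrite (@big_cat_nat _ _ _ n.+1)//= big_nat_recr//=.
by have := S0 0%N n; have := S0 n.+1 N; lra.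
Qed.

(** [q1] and [q2] do not depend on the initial point, so both logarithmic terms cancel; the
    remainder e^(5/2) is sqrt(e) e^2 = o(e^2). *)
Lemma principal_part_diff z z' : V z -> V z' ->
  order2_coef (fun e => area_moment z e - area_moment z' e) (H z - H z').
Proof.
move=> Vz Vz'; have [q1 [q2 hq]] := hpp.
have bnd w : V w -> exists (c : R) (d : R), [/\ 0 < c, 0 < d & forall e, 0 < e < d ->
    nc (area_moment w e - (q1 * (e ^+ 2 * ln e)%:C + H w * (e ^+ 2)%:C
       + q2 * (e `^ (5 / 2) * ln e)%:C)) <= c * (Num.sqrt e * e ^+ 2)].
  move=> Vw; have /eqO_exP[c c0 hc] := hq w Vw.
  move: hc; rewrite near_withinE => /nbhs_ballP[d /= d0 hd].
  exists c, d; split => // e /andP[e0 ed].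
  have := hd e; rewrite /ball/= sub0r normrN gtr0_norm// => /(_ ed e0).
  rewrite ger0_norm ?nc_ge0// => /le_trans; apply; rewrite ler_pM2l//.
  have -> : (5 / 2 : R) = 2^-1 + 2%:R by field.
  rewrite powRD; last by rewrite gt_eqF ?implybT.
  by rewrite powR_mulrn ?(ltW e0)// powR12_sqrt ?(ltW e0)// ger0_norm// mulr_ge0 ?sqrtr_ge0// sqr_ge0.
have [c1 [d1 [c10 d10 hd1]]] := bnd z Vz; have [c2 [d2 [c20 d20 hd2]]] := bnd z' Vz'.
move=> eta eta0; have c0 : 0 < c1 + c2 by lra.
pose d3 := (eta / (c1 + c2)) ^+ 2.
have d30 : 0 < d3 by rewrite exprn_gt0// divr_gt0.
exists (Num.min d1 (Num.min d2 d3)); first by rewrite !lt_min d10 d20.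
move=> e /andP[e0]; rewrite !lt_min => /and3P[e1 e2 e3].
have := hd1 e; have := hd2 e; rewrite e0 e1 e2 => /(_ isT) g2 /(_ isT) g1.
have sq : Num.sqrt e <= eta / (c1 + c2).
  rewrite -(ler_pXn2r (n := 2))// ?nnegrE ?sqrtr_ge0 ?sqr_sqrtr ?(ltW e0)//; first exact: ltW.
  by rewrite divr_ge0 ?ltW.
have x2 : 0 <= e ^+ 2 by rewrite sqr_ge0.
have : (c1 + c2) * (Num.sqrt e * e ^+ 2) <= eta * e ^+ 2.
  rewrite mulrA ler_wpM2r// mulrC; move: sq; rewrite ler_pdivlMr//.
apply: le_trans.
set A := q1 * _ in g1 g2; set B := q2 * _ in g1 g2.
have -> : area_moment z e - area_moment z' e - (e ^+ 2)%:C * (H z - H z') =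
  (area_moment z e - (A + H z * (e ^+ 2)%:C + B)) - (area_moment z' e - (A + H z' * (e ^+ 2)%:C + B)).
  by move: (area_moment z e) (area_moment z' e) => m m'; ring.
apply: (le_trans (nc_subr _ _)); apply: (le_trans (lerD g1 g2)).
by rewrite -mulrDl.
Qed.

Lemma disc_moment (z : C) (e : R) : 0 < e ->
  nc (first_moment (disc z e) - (e ^+ 2)%:C * ((pi : R)%:C * z)) <= 2 * pi * e * e ^+ 2.
Proof.
move=> e0; have := first_moment_bound (bounded_measurable_disc z e0) (fun w h => ltW h).
rewrite area_disc// => b; have -> : 2 * pi * e * e ^+ 2 = 2 * e * (pi * e ^+ 2) by ring.
have -> // : (e ^+ 2)%:C * ((pi : R)%:C * z) = (pi * e ^+ 2)%:C * z.
by rewrite mulrA -rmorphM mulrC [_ ^+ 2 * _]mulrC mulrC.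
Qed.

Lemma functional_equation z : V z -> z != 0 -> H z - H (h z) = (pi : R)%:C * z.
Proof.
move=> Vz z0; apply: order2_coef_unique (principal_part_diff Vz (hV Vz)) _.
have [B hB] := orbit_bounded Vz.
(* The orbit never returns to z, since a periodic orbit of z != 0 would not tend to 0; far iterates
   are near 0, so only finitely many distances remain. *)
have [d d0 hd] : exists2 d : R, 0 < d & forall n, d <= nc (iter n.+1 h z - z).
  have z0' : 0 < nc z by rewrite nc_gt0.
  have [N hN] := @orbit_small z Vz (nc z / 2) ltac:(lra).
  have far n : (N <= n)%N -> nc z / 2 <= nc (iter n h z - z).
    by move=> /hN hn; rewrite ncB; have := nc_sub_ge z (iter n h z); lra.
  have ne n : iter n.+1 h z != z.
    apply/eqP => per; have pn k : iter (k * n.+1) h z = z.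
      by elim: k => [//|k IH]; rewrite mulSn iterD IH.
    have := far (N * n.+1)%N; rewrite pn subrr nc0 => /(_ (leq_pmulr _ _)); first by move=> /(_ isT); lra.
  suff : forall m, exists2 d : R, 0 < d & forall n, (n < m)%N -> d <= nc (iter n.+1 h z - z).
    move=> /(_ N)[d d0 hd]; exists (Num.min d (nc z / 2)); first by rewrite lt_min d0; lra.
    move=> n; have [/hd nd|Nn] := ltnP n N; first by rewrite ge_min nd.
    by rewrite ge_min far ?orbT// (leq_trans Nn).
  elim=> [|m [d d0 hd]]; first by exists 1.
  exists (Num.min d (nc (iter m.+1 h z - z))); first by rewrite lt_min d0 nc_gt0 subr_eq0 ne.
  move=> n; rewrite ltnS leq_eqVlt => /predU1P[->|/hd nd]; first by rewrite ge_min lexx orbT.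
  by rewrite ge_min nd.
move=> eta eta0; have pi0 := pi_gt0 R.
exists (Num.min (d / 2) (eta / (2 * pi))); first by rewrite lt_min !divr_gt0 ?mulr_gt0.
move=> e /andP[e0]; rewrite lt_min => /andP[ed ee].
have bz : bounded_measurable (disc z e) by exact: bounded_measurable_disc.
have bt n : bounded_measurable (tail_nbhd (fun n => iter n h z) e n) by exact: bounded_tail_nbhd hB.
have shiftE : tail_nbhd (fun n => iter n h (h z)) e 0 = tail_nbhd (fun n => iter n h z) e 1.
  apply/seteqP; split => w [n hn wn]; first by exists n.+1; rewrite ?iterSr.
  by case: n hn wn => // n _ wn; exists n; rewrite -?iterSr.
have -> : area_moment z e - area_moment (h z) e = first_moment (disc z e).
  rewrite !orbit_nbhdE shiftE !complex_measureE//.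
  have -> : tail_nbhd (fun n => iter n h z) e 0 = disc z e `|` tail_nbhd (fun n => iter n h z) e 1.
    apply/seteqP; split => w; last by move=> [h1|[n _ h1]]; [exists 0%N|exists n].
    by move=> [[|n] _ h1]; [left|right; exists n.+1].
  rewrite first_momentU ?addrK//.
  apply/seteqP; split => // w [h1 [[|n] // _ h2]].
  have := nc_triangle w (iter n.+1 h z) z; rewrite [nc (_ - w)]ncB.
  by have := hd n; rewrite /disc/= in h1; lra.
apply: (le_trans (disc_moment z e0)); rewrite ler_wpM2r ?sqr_ge0// mulrC.
by move: ee; rewrite ltr_pdivlMr ?mulr_gt0// => /ltW.
Qed.

Lemma functional_equation_iter z m : V z -> z != 0 ->
  H z - H (iter m h z) = (pi : R)%:C * \sum_(0 <= n < m) iter n h z.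
Proof.
move=> Vz z0; elim: m => [|m IH]; first by rewrite big_geq// mulr0 subrr.
rewrite big_nat_recr//= mulrDr -IH -(functional_equation (iterV m Vz) (iter_neq0 m Vz z0)).
by ring.
Qed.

Section Coordinate.
Variables (r M : R) (K : C -> C).
Hypotheses (r0 : 0 < r) (KM : wiener 0 r K M).
Hypothesis hK : forall w, w != 0 -> nc w <= r ->
  h w != 0 /\ - s / h w = - s / w + 1 + w ^+ 2 * K w.
Let F z := - s / h (- s / z).
Local Notation zeta z n := (- s / iter n h z).
Let M0 : 0 <= M. Proof. exact: wiener_ge0 KM. Qed.
Let s1 : nc s = 1. Proof. exact: nc_s s2. Qed.
Let s0 : s != 0. Proof. by rewrite -nc_gt0 s1. Qed.

(** The convention that 0 is its own inverse covers w = 0, so the conjugacy of iterates needs no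
    side condition. *)
Lemma quotient_involutive (w : C) : - s / (- s / w) = w.
Proof.
have [->|w0] := eqVneq w 0; first by rewrite invr0 mulr0 invr0 mulr0.
by field; rewrite w0 s0.
Qed.

Lemma coordinate_map z : r^-1 <= nc z -> F z = z + 1 + (- s / z) ^+ 2 * K (- s / z).
Proof.
move=> rz; have ri : 0 < r^-1 by rewrite invr_gt0.
have z0 : z != 0 by rewrite -nc_gt0; lra.
have w0 : - s / z != 0 by rewrite mulf_neq0 ?oppr_eq0 ?invr_eq0.
have wr : nc (- s / z) <= r.
  by rewrite ncM normcN s1 mul1r ncV -[r]invrK lef_pV2 ?posrE//; lra.
by have [_] := hK w0 wr; rewrite quotient_involutive.
Qed.

Lemma iter_coordinate z k : iter k F (- s / z) = zeta z k.
Proof. by elim: k => //= k ->; rewrite /F quotient_involutive. Qed.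

Lemma orbit_coordinate z k n : iter k F (zeta z n) = zeta z (n + k)%N.
Proof. by rewrite iter_coordinate addnC iterD. Qed.

Local Notation settled z := (deep_point r M z /\ 8 * turning_cst M z + 1 <= complex.Re z).

(** Near 0 each step in the coordinate is within 1/4 of 1, so the real part grows by at least 3/4
    per step until the point is deep. No direction of approach need be assumed. *)
Lemma eventually_settled z : V z -> z != 0 -> exists m, forall n, (m <= n)%N -> settled (zeta z n).
Proof.
move=> Vz z0; have nz n := iter_neq0 n Vz z0.
pose q := Num.min r (Num.min 1 (4 * (M + 1))^-1).
have Mge0 := M0.
have i4 : 0 < (4 * (M + 1))^-1 by rewrite invr_gt0; lra.
have q0 : 0 < q by rewrite !lt_min r0 ltr01 i4.
have [N hN] := orbit_small Vz q0.
have step n : (N <= n)%N -> nc (zeta z n.+1 - zeta z n - 1) <= 4^-1.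
  move=> /hN; rewrite !le_min => /and3P[nr n1 nM].
  have [_] := hK (nz n) nr; rewrite -iterS => ->.
  have -> : - s / iter n h z + 1 + iter n h z ^+ 2 * K (iter n h z) - - s / iter n h z - 1 =
    iter n h z ^+ 2 * K (iter n h z) by ring.
  rewrite ncM ncX; have Kb := wiener_bound KM nr; rewrite add0r in Kb.
  have x0 := nc_ge0 (iter n h z); have y0 := nc_ge0 (K (iter n h z)).
  have x2 : nc (iter n h z) ^+ 2 <= (4 * (M + 1))^-1.
    by rewrite expr2; apply: le_trans nM; rewrite ler_piMl.
  have M1 : 0 < M + 1 by lra.
  apply: (le_trans (ler_pM (exprn_ge0 2 x0) y0 x2 Kb)).
  by rewrite invfM -mulrA ler_piMr// mulrC ler_pdivrMr// mul1r; lra.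
have Re_grow k : complex.Re (zeta z N) + 3 / 4 * k%:R <= complex.Re (zeta z (N + k)).
  elim: k => [|k IH]; first by rewrite mulr0 addr0 addn0.
  rewrite addnS -natr1; have := step (N + k)%N (leq_addr _ _).
  have -> : zeta z (N + k).+1 = zeta z (N + k)%N + (1 + (zeta z (N + k).+1 - zeta z (N + k)%N - 1)).
    by ring.
  move: (zeta z (N + k).+1 - _ - 1) => b bb; rewrite !cReD.
  have := le_trans (Re_le_nc _) bb; rewrite ler_norml /= => /andP[b1 _].
  by lra.
pose X := 8 + 8 * M + r^-1 + 1 + `|complex.Re (zeta z N)|.
have X0 : 0 <= X.
  by rewrite !addr_ge0 ?mulr_ge0 ?invr_ge0 ?(ltW r0).
have [k1 hk1] : exists k : nat, 2 * X < k%:R.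
  by exists (Num.bound (2 * X)); apply: archi_boundP; rewrite mulr_ge0.
have d1 : deep_point r M (zeta z (N + k1)).
  have a1 := normr_ge0 (complex.Re (zeta z N)).
  have := Re_grow k1; have := ler_norm (- complex.Re (zeta z N)); rewrite normrN => g1 g2.
  have ri : 0 < r^-1 by rewrite invr_gt0.
  by rewrite /X in hk1; split; lra.
(* From the deep point on the imaginary part moves by at most 1/2, so the turning threshold stays
   below the fixed [T] while the real part grows past it. *)
pose n1 := (N + k1)%N; pose Y : R := `|complex.Im (zeta z n1)| + 2^-1.
pose T : R := 8 * (4 * (2 * (Y + 2^-1) + 40 * M)) + 1 + X.
have Y0 : 0 <= Y by rewrite addr_ge0.
have T0 : 0 <= T by rewrite /T; lra.
have [k2 hk2] : exists k : nat, T < k%:R by exists (Num.bound T); exact: archi_boundP.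
exists (n1 + k2)%N => n hn.
have nE : n = (n1 + (n - n1))%N by rewrite subnKC// (leq_trans _ hn)// leq_addr.
have k2n : (k2%:R : R) <= (n - n1)%:R by rewrite ler_nat leq_subRL// (leq_trans _ hn)// leq_addr.
have [e1 e2 e3] := d1.
have := Re_zeta r0 s2 KM coordinate_map d1 (n - n1); rewrite orbit_coordinate -/n1 -nE => g1.
have := Im_zeta r0 s2 KM coordinate_map d1 (n - n1); rewrite orbit_coordinate -/n1 -nE -/Y => g2.
rewrite -/n1 in e1 e2 e3 g1.
have ri : 0 < r^-1 by rewrite invr_gt0.
have nX : X <= T by rewrite /T; lra.
have a1 := normr_ge0 (complex.Re (zeta z N)).
have XE : 8 <= X /\ 8 * M <= X /\ r^-1 + 1 <= X by rewrite /X; split; [|split]; lra.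
have b1 : 8 * turning_cst M (zeta z n) + 1 <= T.
  by rewrite /T /turning_cst; move: (complex.Im (zeta z n)) g2 => y g2; lra.
have b2 : T <= complex.Re (zeta z n).
  by move: (complex.Re (zeta z n)) g1 => y g1; lra.
by split; [split|]; lra.
Qed.

Lemma coordinate_orbit z m k : - s / iter k F (zeta z m) = iter (m + k) h z.
Proof. by rewrite orbit_coordinate quotient_involutive. Qed.

Lemma coordinate_orbit' z m k : - s / iter k F (zeta z m) = iter k h (iter m h z).
Proof. by rewrite coordinate_orbit addnC iterD. Qed.

Lemma settled_difference z z' : V z -> V z' ->
  deep_point r M (zeta z 0) /\ 8 * turning_cst M (zeta z 0) + 1 <= complex.Re (zeta z 0) ->
  deep_point r M (zeta z' 0) /\ 8 * turning_cst M (zeta z' 0) + 1 <= complex.Re (zeta z' 0) ->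
  clim (fun N => (pi : R)%:C * \sum_(0 <= n < N) (iter n h z - iter n h z')) (H z - H z').
Proof.
move=> Vz Vz' [d0 t0] [d1 t1] e e0.
set z0 := zeta z 0 in d0 t0; set z1 := zeta z' 0 in d1 t1.
have pE : (fun k => - s / iter k F z0) = (fun k => iter k h z).
  by apply/funext => k; rewrite coordinate_orbit.
have qE : (fun k => - s / iter k F z1) = (fun k => iter k h z').
  by apply/funext => k; rewrite coordinate_orbit.
(* The maximum gives constants b and B common to both orbits. *)
pose L := Num.max (nc z0) (nc z1) + 1.
have L0 : nc z0 + 1 <= L by rewrite lerD2r le_max lexx.
have L1 : nc z1 + 1 <= L by rewrite lerD2r le_max lexx orbT.
pose b := (2 * L ^+ 2)^-1; pose B := 2 + (2 * (nc (z0 - z1) + 1) + 2 * M).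
have n0 := nc_ge0 z0; have n1 := nc_ge0 z1; have n01 := nc_ge0 (z0 - z1).
have Mge0 := M0.
have bb x : 0 <= x -> x + 1 <= L -> 0 < b <= (2 * (x + 1) ^+ 2)^-1.
  move=> x0 xL; have L00 : 0 < L by lra.
  have x1 : 0 < x + 1 by lra.
  rewrite invr_gt0 mulr_gt0 ?exprn_gt0//= lef_pV2 ?posrE ?mulr_gt0 ?exprn_gt0//.
  by rewrite ler_pM2l// ler_pXn2r// nnegrE ltW.
have B2 : 2 <= B by rewrite /B; lra.
have hp := deep_harmonic r0 s2 KM coordinate_map d0 t0 (bb _ n0 L0) B2.
have hq := deep_harmonic r0 s2 KM coordinate_map d1 t1 (bb _ n1 L1) B2.
have pq n := orbit_diff r0 s2 KM coordinate_map d0 d1 n.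
have dpq n := step_diff r0 s2 KM coordinate_map d0 d1 n.
have BE : 2 * (nc (z0 - z1) + 1) + 2 * M <= B by rewrite /B lerDr.
have {}pq n : nc (- s / iter n F z0 - - s / iter n F z1) <= B * omega R n.
  by apply: (le_trans (pq n)); rewrite ler_wpM2r ?(ltW (omega_gt0 R n)).
have {}dpq n : nc (- s / iter n.+1 F z0 - - s / iter n F z0 -
    (- s / iter n.+1 F z1 - - s / iter n F z1)) <= B * omega R n * n.+1%:R^-1.
  apply: (le_trans (dpq n)); rewrite ler_wpM2r ?invr_ge0// ler_wpM2r//.
  exact: ltW (omega_gt0 R n).
have e20 : 0 < e / 2 by rewrite divr_gt0.
have [N hN] := complex_measure_compare hp hq pq dpq e20.
exists N => n /hN[d dd hd]; rewrite ncB.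
have -> : e = 2 * (e / 2) by field.
apply: (order2_coef_near _ (principal_part_diff Vz Vz')); first by lra.
exists d => // e1 /hd; rewrite !orbit_nbhdE pE qE; congr (nc (_ - _ * (_ * _)) <= _).
by apply: eq_bigr => k _; rewrite !coordinate_orbit.
Qed.

(** Both points are advanced by the same m until settled; the functional equation supplies the first
    m terms. *)
Lemma difference_limit z z' : V z -> V z' -> z != 0 -> z' != 0 ->
  clim (fun N => (pi : R)%:C * \sum_(0 <= n < N) (iter n h z - iter n h z')) (H z - H z').
Proof.
move=> Vz Vz' z0 z'0.
have [m1 hm1] := eventually_settled Vz z0; have [m2 hm2] := eventually_settled Vz' z'0.
pose m := maxn m1 m2.
have := settled_difference (iterV m Vz) (iterV m Vz') (hm1 m (leq_maxl _ _)) (hm2 m (leq_maxr _ _)).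
move=> hl; apply: (@clim_shift _ _ _ m).
have -> : H z - H z' = (pi : R)%:C * \sum_(0 <= n < m) (iter n h z - iter n h z')
    + (H (iter m h z) - H (iter m h z')).
  rewrite sumrB mulrBr -!functional_equation_iter//; ring.
apply: clim_eq (climD (clim_cst _) hl) => N.
rewrite [in RHS](@big_cat_nat _ _ _ m) ?leq_addr//= mulrDr; congr (_ + _ * _).
have := @big_addn _ 0 (@GRing.add C) 0 (m + N) m xpredT (fun i => iter i h z - iter i h z').
rewrite add0n addKn => ->; apply: eq_bigr => i _.
by rewrite !iterD.
Qed.

(** If 0 were in V, the expansion at 0, whose neighborhood is a disc of moment O(e^3), would share
    q1 and q2 with that of a nonzero orbit. The latter measure would then be O(e^2), against
    [complex_measure_lower] and the harmonic series. *)
Lemma zero_notin_petal : ~ V 0.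
Proof.
move=> V0; have [d d0 hd] := (near_nc _ _).1 (open_nbhs_nbhs (conj oV V0)).
pose z : C := (d / 2)%:C.
have zn : nc z = d / 2 by rewrite nc_real ger0_norm// divr_ge0// ltW.
have Vz : V z by apply: hd; rewrite subr0 zn; lra.
have z0 : z != 0 by rewrite -nc_gt0 zn divr_gt0.
have [m /(_ m (leqnn _))[dz tz]] := eventually_settled Vz z0.
set w := iter m h z in dz tz; have Vw : V w by exact: iterV.
set z1 := - s / w in dz tz.
have L0 : 0 < nc z1 + 1 by have := nc_ge0 z1; lra.
have b0 : 0 < (2 * (nc z1 + 1) ^+ 2)^-1 <= (2 * (nc z1 + 1) ^+ 2)^-1.
  by rewrite lexx invr_gt0 mulr_gt0// exprn_gt0.
have hp := deep_harmonic r0 s2 KM coordinate_map dz tz b0 (lexx 2).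
have pE k : - s / iter k F z1 = iter k h w by rewrite coordinate_orbit'.
(* t is the real number -s, which turns the orbit to the side of positive real parts. *)
have [t t1 tE] : exists2 t : R, `|t| = 1 & forall x : C, t * complex.Re (- s / x) = complex.Re x^-1.
  have /orP[/eqP ->|/eqP ->] : (s == 1) || (s == -1) by rewrite -sqrf_eq1 s2.
    exists (-1); first by rewrite normrN normr1.
    by move=> x; rewrite !mulN1r cReN opprK.
  by exists 1; [rewrite normr1|move=> x; rewrite opprK !mul1r].
have low k := Re_inv_zeta_lower r0 s2 KM coordinate_map dz k.
have tpos n : 0 <= t * complex.Re (- s / iter n F z1).
  rewrite tE; apply: le_trans (low n).
  by rewrite mulr_ge0 ?invr_ge0 ?exprn_ge0 ?(ltW L0).
pose c := H w - H 0.
have pi0 := pi_gt0 R.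
(* The 3 collects the error of the lower bound, the tolerance 1 in the difference of expansions, and
   the moment of the disc at 0, at most e^2 once e <= 1 / (2 pi). *)
have bound N : pi * (\sum_(0 <= n < N) t * complex.Re (- s / iter n F z1)) <= nc c + 3.
  have [d1 d10 hd1] := complex_measure_lower hp t1 tpos N.
  have [d2 d20 hd2] := principal_part_diff Vw V0 (@ltr01 R).
  pose d3 : R := (2 * pi)^-1; have d30 : 0 < d3 by rewrite invr_gt0 mulr_gt0.
  pose e := Num.min d1 (Num.min d2 d3) / 2.
  have m0 : 0 < Num.min d1 (Num.min d2 d3) by rewrite !lt_min d10 d20.
  have e0 : 0 < e by rewrite divr_gt0.
  have : e < Num.min d1 (Num.min d2 d3) by rewrite /e; lra.
  rewrite !lt_min => /and3P[e1 e2 e3].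
  have := hd1 e; rewrite e0 e1 => /(_ isT).
  have -> : (fun k => - s / iter k F z1) = (fun k => iter k h w) by apply/funext => k; rewrite pE.
  rewrite -orbit_nbhdE.
  have := hd2 e; rewrite e0 e2 => /(_ isT).
  have it0 n : iter n h 0 = 0 by elim: n => //= n ->.
  have -> : area_moment 0 e = first_moment (disc 0 e).
    have -> : eps_nbhd (forward_orbit h 0) e = disc 0 e.
      rewrite orbit_nbhdE; apply/seteqP; split => x; first by move=> [n _]; rewrite it0.
      by move=> hx; exists 0%N.
    by rewrite complex_measureE//; exact: bounded_measurable_disc.
  have := disc_moment 0 e0; rewrite !mulr0 subr0 mul1r -/c => h1 h2 h3.
  have e2' : 0 < e ^+ 2 by rewrite exprn_gt0.
  have h4 : 2 * pi * e * e ^+ 2 <= e ^+ 2.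
    by rewrite ler_piMl ?(ltW e2')// mulrC -ler_pdivlMr ?mulr_gt0// div1r ltW.
  have h5 : nc (area_moment w e) <= (nc c + 2) * e ^+ 2.
    have -> : area_moment w e = (area_moment w e - first_moment (disc 0 e) - (e ^+ 2)%:C * c)
      + (first_moment (disc 0 e) + (e ^+ 2)%:C * c) by ring.
    apply: (le_trans (le_normcD _ _)).
    have := le_normcD (first_moment (disc 0 e)) ((e ^+ 2)%:C * c).
    by rewrite ncM nc_real ger0_norm ?(ltW e2')//; lra.
  by have := le_trans h3 h5; rewrite ler_pM2r//; lra.
have hB N : \sum_(0 <= n < N) (n.+1%:R^-1 : R) <= (nc c + 3) / pi * (nc z1 + 1) ^+ 2.
  rewrite -ler_pdivrMr ?exprn_gt0// ler_pdivlMr// mulrC; apply: le_trans (bound N).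
  rewrite ler_pM2l// mulrC mulr_sumr; apply: ler_sum => n _.
  by rewrite tE; exact: low.
have : cvgn (series (@harmonic R)).
  apply: nondecreasing_is_cvgn; last by exists ((nc c + 3) / pi * (nc z1 + 1) ^+ 2) => _ [N _ <-]; exact: hB.
  move=> i j ij; rewrite /series/= [X in _ <= X](@big_cat_nat _ _ _ i)//=.
  by rewrite lerDl sumr_ge0// => k _; rewrite /harmonic/= invr_ge0.
exact: dvg_harmonic.
Qed.

Lemma analytic_iter z n : V z -> analytic_at (iter n h) z.
Proof.
move=> Vz; elim: n => [|n IH]; first exact: analytic_id.
exact: (@analytic_comp R h (iter n h) z (aV (iterV n Vz)) IH).
Qed.

Lemma principal_part_analytic z0 : V z0 -> analytic_at H z0.
Proof.
move=> Vz0; have z00 : z0 != 0 by apply/eqP => z00; apply: zero_notin_petal; rewrite -z00.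
have [m /(_ m (leqnn _))[dz _]] := eventually_settled Vz0 z00.
set zeta0 := zeta z0 m in dz.
have [T hT] : exists T : C -> C, forall u, nc u <= 4^-1 ->
    clim (fun N => \sum_(0 <= k < N) ((iter k F (zeta0 + u))^-1 - (iter k F zeta0)^-1)) (T (zeta0 + u)).
  have : forall x : C, exists y : C, nc (x - zeta0) <= 4^-1 ->
      clim (fun N => \sum_(0 <= k < N) ((iter k F x)^-1 - (iter k F zeta0)^-1)) y.
    move=> x; have [le|nle] := boolP (nc (x - zeta0) <= 4^-1); last by exists 0.
    by have [y] := iter_diff_clim r0 s2 KM coordinate_map dz le; rewrite subrKC; exists y.
  move=> /choice[T hT]; exists T => u ur; apply: hT.
  by rewrite [zeta0 + u - zeta0]addrAC subrr add0r.
have aT : analytic_at T zeta0.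
  apply: (wiener_analytic _ (iter_diff_series r0 s2 KM coordinate_map dz hT)).
  by rewrite invr_gt0.
have apsi : analytic_at (fun z => zeta z m) z0.
  have ai := analytic_inv (iter_neq0 m Vz0 z00).
  exact: (analytic_scale (- s) (analytic_comp ai (analytic_iter m Vz0))).
have q0 : (0 : R) < 4^-1 by rewrite invr_gt0.
have [d1 d10 hd1] := analytic_continuous apsi q0.
have [d2 d20 hd2] := (near_nc _ _).1 (open_nbhs_nbhs (conj oV Vz0)).
have d30 : 0 < nc z0 by rewrite nc_gt0.
(* The three bounds keep the coordinate of z within 1/4 of [zeta0], z in V, and z != 0. *)
pose d := Num.min d1 (Num.min d2 (nc z0)).
have d0 : 0 < d by rewrite !lt_min d10 d20.
apply: (@analytic_eq _ (fun z => H z0 + (pi : R)%:C *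
  (\sum_(0 <= n < m) (iter n h z + - iter n h z0) + - s * T (zeta z m))) H z0 d d0); last first.
  have a1 n := analytic_add (analytic_iter n Vz0) (analytic_cst (- iter n h z0) z0).
  have a2 := analytic_scale (- s) (@analytic_comp _ T (fun z => zeta z m) z0 aT apsi).
  exact: (analytic_add (analytic_cst _ _)
    (analytic_scale _ (analytic_add (analytic_sum m a1) a2))).
move=> z; rewrite !lt_min => /and3P[z1 z2 z3].
have Vz : V z by exact: hd2.
have zn0 : z != 0.
  by rewrite -nc_gt0; have := nc_sub_ge z0 z; rewrite ncB; lra.
suff : H z - H z0 = (pi : R)%:C *
    (\sum_(0 <= n < m) (iter n h z + - iter n h z0) + - s * T (zeta z m)).
  by move=> <-; rewrite subrKC.
apply: clim_unique (difference_limit Vz Vz0 zn0 z00) _.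
apply: climZ; apply: (@clim_shift _ _ _ m).
have := hT (zeta z m - zeta0) (hd1 z z1); rewrite subrKC => hTz.
apply: clim_eq (climD (clim_cst _) (climZ (- s) hTz)) => N.
rewrite [in RHS](@big_cat_nat _ _ _ m) ?leq_addr//=; congr (_ + _).
have := @big_addn _ 0 (@GRing.add C) 0 (m + N) m xpredT (fun i => iter i h z - iter i h z0).
rewrite add0n addKn => ->; rewrite mulr_sumr; apply: eq_bigr => k _.
by rewrite mulrBr !coordinate_orbit addnC.
Qed.

End Coordinate.

Lemma principal_part_theory :
  analytic_on V H /\ forall z, V z -> H z - H (h z) = (pi : R)%:C * z.
Proof.
have [r [K [M [r0 KM hK]]]] := conjugate_form s2 a0 ho3.
split => z Vz; first exact: principal_part_analytic r0 KM hK _ Vz.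
apply: functional_equation => //; apply/eqP => z0.
by apply: (zero_notin_petal r0 KM hK); rewrite -z0.
Qed.

End PrincipalPart.

Unset Implicit Arguments.

Theorem theorem4p6 (R : realType) (U : set R[i]) (f g : R[i] -> R[i])
  (Vp Vm : set R[i]) (Hf Hg : R[i] -> R[i])
  (f_diffeo : analytic_diffeo U f g)
  (f_jet : jet3 f)
  (petal_p : petal (-1) U f Vp)
  (petal_m : petal 1 (f @` U) g Vm) :
  (principal_part f Vp Hf ->
     analytic_on Vp Hf /\
     forall z, Vp z -> Hf z - Hf (f z) = (pi : R)%:C * z) /\
  (principal_part g Vm Hg ->
     analytic_on Vm Hg /\
     forall z, Vm z -> Hg z - Hg (g z) = (pi : R)%:C * z).
Proof.
have [[oU U0] f0 af [oV ag] gf] := f_diffeo.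
have g0 : g 0 = 0 by rewrite -{1}f0 gf.
have fU0 : (f @` U) 0 by exists 0.
have fo := small_o3_jet3 f_jet.
have go := small_o3_inverse oU U0 oV f0 (af _ U0) (ag _ fU0) gf fo.
have [oVp VpU _ fVp cvgp] := petal_p; have [oVm VmU _ gVm cvgm] := petal_m.
split => pp.
- apply: (principal_part_theory (s := 1)) pp => //; first by rewrite expr1n.
  + by move=> z /VpU; exact: af.
  + exact: af.
  + by move=> z /VpU Uz fz; rewrite -(gf z Uz) fz g0.
- apply: (principal_part_theory (s := -1)) pp => //; first by rewrite sqrrN expr1n.
  + by move=> z /VmU; exact: ag.
  + exact: ag.
  + by move=> z /VmU[u Uu <-]; rewrite gf// => ->.
Qed.
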